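(* In the model described in the context, suppose that $\epsilon_{\mathrm W}>\epsilon_{\mathrm{th}}$ (high SU access rate regime). Then the policy $\mu^*$ returned by Algorithm 1 (described in the context) is an optimal policy for the problem $$\max_{\mu\in\mathcal U}\ \bar T_s(\mu)\quad\text{subject to}\quad \bar W_s(\mu)\le\epsilon_{\mathrm W},$$ i.e. $\bar W_s(\mu^* )\le\epsilon_{\mathrm W}$ and $\bar T_s(\mu^* )\ge\bar T_s(\mu)$ for every $\mu\in\mathcal U$ with $\bar W_s(\mu)\le\epsilon_{\mathrm W}$.
   Context: **Channel constants.** $\gamma_s,\gamma_p,\gamma_{sp},\gamma_{ps}$ are independent nonnegative random variables (SNRs of the links SUtx→SUrx, PUtx→PUrx, SUtx→PUrx, PUtx→SUrx; PU = primary user, SU = secondary user), $C(x)=\log_2(1+x)$, and $R_p,R_{s\mathrm U},R_{s\mathrm K}>0$ are fixed rates, where $R_{s\mathrm K}$ maximizes $R\mapsto R\Pr(R<C(\gamma_s))$. Put $q_{pp}^{(\mathrm I)}=\Pr(R_p>C(\gamma_p))$, $q_{pp}^{(\mathrm A)}=\Pr(R_p>C(\gamma_p/(1+\gamma_{sp})))$, $q_{ps}^{(\mathrm I)}=\Pr(R_p>C(\gamma_{ps}))$. Let $M$ be the set of pairs $(\gamma_s,\gamma_{ps})$ with $R_{s\mathrm U}\le C(\gamma_s)$, $R_p\le C(\gamma_{ps})$, $R_{s\mathrm U}+R_p\le C(\gamma_s+\gamma_{ps})$; $\Gamma_{\mathrm p}=M\cup\{R_{s\mathrm U}>C(\gamma_s),\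 R_p\le C(\gamma_{ps}/(1+\gamma_s))\}$; $\Gamma_{\mathrm s}=M\cup\{R_p>C(\gamma_{ps}),\ R_{s\mathrm U}\le C(\gamma_s/(1+\gamma_{ps}))\}$; $\Gamma_{\mathrm{buf}}=(\Gamma_{\mathrm p}\cup\Gamma_{\mathrm s})^c\cap\{R_{s\mathrm U}\le C(\gamma_s)\}$. Put $q_{ps}^{(\mathrm A)}=\Pr((\gamma_s,\gamma_{ps})\notin\Gamma_{\mathrm p})$, $p_{s,\mathrm{buf}}=\Pr((\gamma_s,\gamma_{ps})\in\Gamma_{\mathrm{buf}})$, $T_{s\mathrm U}=R_{s\mathrm U}\Pr((\gamma_s,\gamma_{ps})\in\Gamma_{\mathrm s})$, $T_{s\mathrm K}=R_{s\mathrm K}\Pr(R_{s\mathrm K}<C(\gamma_s))$. Standing relations: $q_{pp}^{(\mathrm A)}\ge q_{pp}^{(\mathrm I)}$, $q_{ps}^{(\mathrm A)}>q_{ps}^{(\mathrm I)}$, $p_{s,\mathrm{buf}}>0$, $T_{s\mathrm K}\ge T_{s\mathrm U}+p_{s,\mathrm{buf}}R_{s\mathrm U}>T_{s\mathrm U}$; nondegeneracy: $q_{pp}^{(\mathrm I)}>0$, $q_{pp}^{(\mathrm A)}<1$, $q_{ps}^{(\mathrm I)}>0$. **Markov decision process.** Let $D\ge1$ be an integer (ARQ deadline). $\mathcal S=\mathcal S_{\mathrm U}\cup\mathcal S_{\mathrm K}$ with $\mathcal S_{\mathrm U}=\{(t,b,\mathrm U):1\le t\le D,\ 0\le b\le t-1\}$,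 $\mathcal S_{\mathrm K}=\{(t,0,\mathrm K):2\le t\le D\}$. The set of policies is $\mathcal U=\{\mu:\mathcal S\to[0,1]\}$; in state $\mathbf s$ action $\mathrm A$ (SU active) is taken with probability $\mu(\mathbf s)$, otherwise action $\mathrm I$ (idle). Transitions for action $X\in\{\mathrm A,\mathrm I\}$: from $(t,b,\mathrm U)$ with $t<D$: to $(1,0,\mathrm U)$ with probability $1-q_{pp}^{(X)}$; to $(t+1,0,\mathrm K)$ with probability $q_{pp}^{(X)}(1-q_{ps}^{(X)})$; if $X=\mathrm A$, to $(t+1,b+1,\mathrm U)$ with probability $q_{pp}^{(\mathrm A)}p_{s,\mathrm{buf}}$ and to $(t+1,b,\mathrm U)$ with probability $q_{pp}^{(\mathrm A)}(q_{ps}^{(\mathrm A)}-p_{s,\mathrm{buf}})$; if $X=\mathrm I$, to $(t+1,b,\mathrm U)$ with probability $q_{pp}^{(\mathrm I)}q_{ps}^{(\mathrm I)}$; from $(t,0,\mathrm K)$ with $t<D$: to $(1,0,\mathrm U)$ with probability $1-q_{pp}^{(X)}$ and to $(t+1,0,\mathrm K)$ with probability $q_{pp}^{(X)}$; from any state with $t=D$: to $(1,0,\mathrm U)$ with probability $1$. The expected SU throughput in one slot is $T_{s\mathrm K}$ in $(t,0,\mathrm K)$ under $\mathrm A$, $0$ in $(t,0,\mathrm K)$ under $\mathrm I$, $T_{s\mathrm U}+(1-q_{ps}^{(\mathrm A)})bR_{s\mathrm U}$ in $(t,b,\mathrm U)$ under $\mathrm A$, and $(1-q_{ps}^{(\mathrm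 I)})bR_{s\mathrm U}$ in $(t,b,\mathrm U)$ under $\mathrm I$. $\bar T_s(\mu)$ is the long-term average expected SU throughput per slot under $\mu$, and $\bar W_s(\mu)$ is the long-term average expected number of uses of action $\mathrm A$ per slot; both are limits of time averages $\frac1N\mathbb E[\sum_{n=0}^{N-1}\cdot]$ and do not depend on the initial state. **Constraint level.** $\epsilon_{\mathrm W}=\min\left\{\frac{(1-q_{pp}^{(\mathrm I)})\epsilon_{\mathrm{PU}}}{q_{pp}^{(\mathrm A)}-q_{pp}^{(\mathrm I)}},\frac{\mathcal P_s^{(\mathrm{th})}}{P_s}\right\}$ with given $\epsilon_{\mathrm{PU}}\in[0,1]$, $P_s>0$, $\mathcal P_s^{(\mathrm{th})}\in[0,P_s]$ (the first term is read as $+\infty$ if its denominator is $0$). $\epsilon_{\mathrm{th}}=\bar W_s(\mu)$ for the policy $\mu$ equal to $1$ on $\mathcal S_{\mathrm K}$ and $0$ on $\mathcal S_{\mathrm U}$. **Secondary access efficiency.** For $\mu\in\mathcal U$ and $\mathbf s\in\mathcal S$, let $\tilde\mu\in\mathcal U$ be a policy under which $\mathbf s$ is accessible from $(1,0,\mathrm U)$ (e.g. $\tilde\mu\equiv 1/2$), let $\mu_\upsilon=(1-\upsilon)\mu+\upsilon\tilde\mu$, and define $$\eta_\mu(\mathbf s)=\lim_{\upsilon\to0^+}\frac{\partial\bar T_s/\partial\mu(\mathbf s)}{\partial\bar W_s/\partial\mu(\mathbf s)}\bigg|_{\mu_\upsilon},$$ where $\partial/\partial\mu(\mathbf s)$ is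 the derivative with respect to the single coordinate $\mu(\mathbf s)$. **Algorithm 1.** Let $\delta_{\mathbf s}:\mathcal S\to\{0,1\}$ be the indicator function of state $\mathbf s$. 1) Initialization: $\mu^{(0)}=0$ on $\mathcal S_{\mathrm U}$, $\mu^{(0)}=1$ on $\mathcal S_{\mathrm K}$, $\mathcal S_{\mathrm{idle}}^{(0)}=\mathcal S_{\mathrm U}$, $i=0$. 2) Stage $i$: (a) compute $\eta_{\mu^{(i)}}(\mathbf s)$ for all $\mathbf s\in\mathcal S_{\mathrm{idle}}^{(i)}$ and let $\mathbf s^{(i)}\in\arg\max_{\mathbf s\in\mathcal S_{\mathrm{idle}}^{(i)}}\eta_{\mu^{(i)}}(\mathbf s)$. (b) If $\eta_{\mu^{(i)}}(\mathbf s^{(i)})\le0$, go to 3); otherwise let $\mu^{(i+1)}=\mu^{(i)}+\delta_{\mathbf s^{(i)}}$ and $\mathcal S_{\mathrm{idle}}^{(i+1)}=\mathcal S_{\mathrm{idle}}^{(i)}\setminus\{\mathbf s^{(i)}\}$. (c) Set $i:=i+1$; if $\mathcal S_{\mathrm{idle}}^{(i)}=\emptyset$ go to 3), otherwise repeat 2). 3) Let $\mu^{(0)},\dots,\mu^{(N-1)}$ be the sequence of all policies produced ($N=i+1$ for the final value of $i$). 4) Output: if $\bar W_s(\mu^{(N-1)})\le\epsilon_{\mathrm W}$, then $\mu^*=\mu^{(N-1)}$. Otherwise $\mu^*=\lambda\mu^{(j)}+(1-\lambda)\mu^{(j+1)}$, where $j=\max\{i:\bar W_s(\mu^{(i)})\le\epsilon_{\mathrm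 W}\}$ and $\lambda\in(0,1]$ is the unique solution of $\bar W_s(\lambda\mu^{(j)}+(1-\lambda)\mu^{(j+1)})=\epsilon_{\mathrm W}$. *)

(* Defs.v *)
From HB Require Import structures.
From mathcomp Require Import all_boot all_order all_algebra.
From mathcomp Require Import all_classical all_reals all_analysis.
Set Implicit Arguments.
Unset Strict Implicit.
Unset Printing Implicit Defensive.
Import Order.TTheory GRing.Theory Num.Theory.
Import numFieldNormedType.Exports.
Local Open Scope classical_set_scope.
Local Open Scope ring_scope.

Definition mutually_independent (R : realType) (d : measure_display)
    (Om : measurableType d) (P : probability Om R) (I : finType)
    (X : I -> {RV P >-> R}) : Prop :=
  forall (J : {set I}) (B : I -> set R), (forall i, measurable (B i)) ->
    P (\bigcap_(i in [set` J]) (X i @^-1` B i)) =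
    (\prod_(i in J) P (X i @^-1` B i))%E.

Inductive action := Active | Idle.

(* [gs], [gp], [gsp], [gps] are the SNRs of the links SUtx->SUrx, PUtx->PUrx,
   SUtx->PUrx and PUtx->SUrx. *)
Record channel (R : realType) (d : measure_display) (Om : measurableType d)
    (P : probability Om R) := Channel {
  gs : {RV P >-> R};
  gp : {RV P >-> R};
  gsp : {RV P >-> R};
  gps : {RV P >-> R};
  Rp : R;
  RsU : R;
  RsK : R }.

Definition capacity (R : realType) (x : R) : R := ln (1 + x) / ln 2.

Section Channel.
Context {R : realType} {d : measure_display} {Om : measurableType d}.
Context {P : probability Om R}.
Variable ch : channel P.
Local Notation C := (@capacity R).

Definition Pr (A : set Om) : R := fine (P A).

(* Sets of SNR pairs [g = (gamma_s, gamma_ps)]. *)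
Definition Gamma_both : set (R * R) :=
  [set g | [/\ RsU ch <= C g.1, Rp ch <= C g.2 &
               RsU ch + Rp ch <= C (g.1 + g.2)]].

Definition Gamma_p : set (R * R) :=
  Gamma_both `|`
  [set g | RsU ch > C g.1 /\ Rp ch <= C (g.2 / (1 + g.1))].

Definition Gamma_s : set (R * R) :=
  Gamma_both `|`
  [set g | Rp ch > C g.2 /\ RsU ch <= C (g.1 / (1 + g.2))].

Definition Gamma_buf : set (R * R) :=
  ~` (Gamma_p `|` Gamma_s) `&` [set g | RsU ch <= C g.1].

Definition snr_in (G : set (R * R)) : set Om :=
  [set w | G (gs ch w, gps ch w)].

Definition ch_qpp (a : action) : R :=
  match a with
  | Active => Pr [set w | Rp ch > C (gp ch w / (1 + gsp ch w))]
  | Idle => Pr [set w | Rp ch > C (gp ch w)]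
  end.

Definition ch_qps (a : action) : R :=
  match a with
  | Active => Pr (snr_in (~` Gamma_p))
  | Idle => Pr [set w | Rp ch > C (gps ch w)]
  end.

Definition ch_pbuf : R := Pr (snr_in Gamma_buf).

Definition ch_TsU : R := RsU ch * Pr (snr_in Gamma_s).

Definition rateK_throughput (r : R) : R := r * Pr [set w | r < C (gs ch w)].

Definition ch_TsK : R := rateK_throughput (RsK ch).

Record channel_assumptions : Prop := {
  snr_independent :
    mutually_independent (tnth [tuple gs ch; gp ch; gsp ch; gps ch]);
  snr_ge0 : forall w,
    [/\ 0 <= gs ch w, 0 <= gp ch w, 0 <= gsp ch w & 0 <= gps ch w];
  rates_gt0 : [/\ 0 < Rp ch, 0 < RsU ch & 0 < RsK ch];
  RsK_max : forall r, 0 < r -> rateK_throughput r <= rateK_throughput (RsK ch);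
  qpp_le : ch_qpp Idle <= ch_qpp Active;
  qps_lt : ch_qps Idle < ch_qps Active;
  pbuf_gt0 : 0 < ch_pbuf;
  TsK_ge : ch_TsU + ch_pbuf * RsU ch <= ch_TsK;
  TsU_lt : ch_TsU < ch_TsU + ch_pbuf * RsU ch;
  qppI_gt0 : 0 < ch_qpp Idle;
  qppA_lt1 : ch_qpp Active < 1;
  qpsI_gt0 : 0 < ch_qps Idle }.

End Channel.

Record mdp_params (R : realType) := MdpParams {
  qpp : action -> R;
  qps : action -> R;
  pbuf : R;
  TsU : R;
  TsK : R;
  rsU : R }.

Definition params_of_channel (R : realType) (d : measure_display)
    (Om : measurableType d) (P : probability Om R) (ch : channel P) :
    mdp_params R :=
  MdpParams (ch_qpp ch) (ch_qps ch) (ch_pbuf ch) (ch_TsU ch) (ch_TsK ch)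
    (RsU ch).

(* A triple [(t, b, k)] is a state (t, b, U) if [k = false] and a state
   (t, b, K) if [k = true]. *)
Definition valid_state (D : nat) (x : 'I_D.+1 * 'I_D.+1 * bool) : bool :=
  let: (t, b, k) := x in
  if k then (2 <= t)%N && (b == 0%N :> nat) else (1 <= t)%N && (b <= t.-1)%N.

Definition state (D : nat) : finType :=
  {x : 'I_D.+1 * 'I_D.+1 * bool | valid_state x}.

Definition slot (D : nat) (s : state D) : nat := (val s).1.1.
Definition buffered (D : nat) (s : state D) : nat := (val s).1.2.
Definition known (D : nat) (s : state D) : bool := (val s).2.

Definition at_U (D : nat) (s : state D) (t b : nat) : bool :=
  [&& slot s == t, buffered s == b & ~~ known s].

Definition at_K (D : nat) (s : state D) (t : nat) : bool :=
  (slot s == t) && known s.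

Definition start (D : nat) (hD : (0 < D)%N) : state D :=
  exist (@valid_state D) (@Ordinal D.+1 1 hD, ord0, false) isT.

Definition S_U (D : nat) : {set state D} := [set s | ~~ known s].

Definition is_policy (R : realType) (D : nat) (mu : state D -> R) : Prop :=
  forall s, 0 <= mu s <= 1.

Definition mix (R : realType) (D : nat) (l : R) (mu nu : state D -> R) :
    state D -> R :=
  fun s => l * mu s + (1 - l) * nu s.

(* The policy [mu + h * delta_s]. *)
Definition shift (R : realType) (D : nat) (mu : state D -> R) (s : state D)
    (h : R) : state D -> R :=
  fun s' => mu s' + h * (s' == s)%:R.

Section MDP.
Context {R : realType}.
Variables (m : mdp_params R) (D : nat).
Local Notation policy := (state D -> R).

Definition trans (s : state D) (a : action) (s' : state D) : R :=
  let t := slot s in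
  let b := buffered s in
  if t == D then (at_U s' 1 0)%:R
  else if known s then
    (1 - qpp m a) * (at_U s' 1 0)%:R + qpp m a * (at_K s' t.+1)%:R
  else
    (1 - qpp m a) * (at_U s' 1 0)%:R
    + qpp m a * (1 - qps m a) * (at_K s' t.+1)%:R
    + match a with
      | Active =>
          qpp m Active * pbuf m * (at_U s' t.+1 b.+1)%:R
          + qpp m Active * (qps m Active - pbuf m) * (at_U s' t.+1 b)%:R
      | Idle => qpp m Idle * qps m Idle * (at_U s' t.+1 b)%:R
      end.

Definition throughput (s : state D) (a : action) : R :=
  if known s then
    match a with Active => TsK m | Idle => 0 end
  else
    match a with Active => TsU m | Idle => 0 end
    + (1 - qps m a) * (buffered s)%:R * rsU m.

Definition access (s : state D) (a : action) : R :=
  match a with Active => 1 | Idle => 0 end.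

Definition average_action (mu : policy) (s : state D) (f : action -> R) : R :=
  mu s * f Active + (1 - mu s) * f Idle.

(* Law of the state in slot [n] under [mu], starting from [s0]. *)
Fixpoint state_law (mu : policy) (s0 : state D) (n : nat) : state D -> R :=
  match n with
  | 0 => fun s => (s == s0)%:R
  | n'.+1 => fun s' => \sum_(s : state D)
      state_law mu s0 n' s * average_action mu s (fun a => trans s a s')
  end.

Definition expected_reward (r : state D -> action -> R) (mu : policy)
    (s0 : state D) (n : nat) : R :=
  \sum_(s : state D) state_law mu s0 n s * average_action mu s (r s).

Definition long_run_average (r : state D -> action -> R) (s0 : state D)
    (mu : policy) : R :=
  lim ((fun N : nat => N%:R^-1 * \sum_(n < N) expected_reward r mu s0 n)
       @ \oo).

Definition Tbar (s0 : state D) (mu : policy) : R :=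
  long_run_average throughput s0 mu.

Definition Wbar (s0 : state D) (mu : policy) : R :=
  long_run_average access s0 mu.

Definition accessible (mu : policy) (s s' : state D) : Prop :=
  exists n, 0 < state_law mu s n s'.

(* Derivative of [F] in the coordinate [mu s]; since [F] is a function on
   policies, only increments that keep [mu s] in [0, 1] are considered (at an
   end point of [0, 1] it is the one-sided derivative). *)
Definition partial (F : policy -> R) (s : state D) (mu : policy) : R :=
  lim ((fun h : R => h^-1 * (F (shift mu s h) - F mu))
       @ within [set h : R | 0 <= mu s + h <= 1] 0^').

(* [mut] is the auxiliary policy of the perturbation. *)
Definition efficiency (s0 : state D) (mut mu : policy) (s : state D) : R :=
  lim ((fun v : R =>
          partial (Tbar s0) s (mix (1 - v) mu mut)
          / partial (Wbar s0) s (mix (1 - v) mu mut)) @ 0^'+).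

Definition mu_init : policy := fun s => (known s)%:R.

Definition eps_th (s0 : state D) : R := Wbar s0 mu_init.

Definition eps_W (epsPU Pth Ps : R) : R :=
  if qpp m Active - qpp m Idle == 0 then Pth / Ps
  else Num.min ((1 - qpp m Idle) * epsPU / (qpp m Active - qpp m Idle))
         (Pth / Ps).

(* [pick mu A] selects a maximizer of [eta mu] on the set [A]. The idle sets of
   the successive stages are distinct, so every way of breaking ties in a run
   of the algorithm is given by such a function. *)
Definition argmax_rule (eta : policy -> state D -> R)
    (pick : policy -> {set state D} -> state D) : Prop :=
  forall (mu : policy) (A : {set state D}), is_policy mu -> A != finset.set0 ->
    pick mu A \in A /\ forall s, s \in A -> eta mu s <= eta mu (pick mu A).

(* Policies produced from [mu] on with idle set [A]; [fuel] only has to be at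
   least [#|A|], since each stage removes one state from [A]. *)
Fixpoint stages (eta : policy -> state D -> R)
    (pick : policy -> {set state D} -> state D)
    (fuel : nat) (mu : policy) (A : {set state D}) : seq policy :=
  mu :: match fuel with
        | 0 => [::]
        | fuel'.+1 =>
            if A == finset.set0 then [::]
            else let s := pick mu A in
                 if eta mu s <= 0 then [::]
                 else stages eta pick fuel' (shift mu s 1) (A :\ s)%SET
        end.

Definition algorithm_policies (eta : policy -> state D -> R)
    (pick : policy -> {set state D} -> state D) : seq policy :=
  stages eta pick #|S_U D| mu_init (S_U D).

Definition algorithm_output (s0 : state D) (eta : policy -> state D -> R)
    (pick : policy -> {set state D} -> state D) (epsW : R) : policy :=
  let mus := algorithm_policies eta pick in
  let N := size mus in
  let mu_ i := nth mu_init mus i in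
  if Wbar s0 (mu_ N.-1) <= epsW then mu_ N.-1
  else
    let j := (\max_(i < N | (Wbar s0 (mu_ i) <= epsW)%R) i)%N in
    let lambda := get [set l : R | 0 < l <= 1 /\
                         Wbar s0 (mix l (mu_ j) (mu_ j.+1)) = epsW] in
    mix lambda (mu_ j) (mu_ j.+1).

Definition optimal (s0 : state D) (epsW : R) (mu : policy) : Prop :=
  [/\ is_policy mu, Wbar s0 mu <= epsW &
      forall nu, is_policy nu -> Wbar s0 nu <= epsW ->
        Tbar s0 nu <= Tbar s0 mu].

End MDP.

(* Main.v *)
Require Import Defs.
From HB Require Import structures.
From mathcomp Require Import all_boot all_order all_algebra.
From mathcomp Require Import all_classical all_reals all_analysis.
From mathcomp Require Import measurable_realfun ring lra.
Set Implicit Arguments.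
Unset Strict Implicit.
Unset Printing Implicit Defensive.
Import Order.TTheory GRing.Theory Num.Theory.
Import numFieldNormedType.Exports.
Local Open Scope classical_set_scope.
Local Open Scope ring_scope.

(* A cycle, i.e. an excursion from the start state, visits every state at most
   once, so long-run averages are quotients of expected cycle totals and these
   totals are affine in each coordinate of the policy. Hence the efficiency of
   [s] is the quotient of the advantages of activity in [s] for throughput and
   for access, both corrected by their own gains, and its perturbation limit is
   just evaluation at [mu] as long as the access advantage is nonzero.

   The key fact is that the access advantage of a U state is positive whenever
   all K states are active. Thus, for policies active on K, each sign condition
   of the optimality test for the Lagrangian Tbar - l * Wbar changes at most once
   as the multiplier l decreases, namely at the efficiency of the state. At
   that multiplier, activating the state alters neither the gain nor any
   advantage, so Algorithm 1 traces the parametric optimum as l decreases from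
   +oo to 0. Finally Tbar <= TsK * Wbar, with equality for the initial policy;
   this forces l <= TsK at the crossing of a level eps_W > eps_th, and for such
   l activity on K is optimal among all policies. *)

(** The channel model enters the analysis of the decision process only through these
    inequalities. *)
Record admissible (R : realType) (m : mdp_params R) : Prop := {
  qpp_itv : forall a, 0 < qpp m a < 1;
  qpp_mono : qpp m Idle <= qpp m Active;
  qps_itv : forall a, 0 <= qps m a <= 1;
  pbuf_itv : 0 <= pbuf m <= qps m Active;
  rsU_ge0 : 0 <= rsU m;
  TsK_ge0 : 0 <= TsK m;
  TsU_pbuf_le : TsU m + pbuf m * rsU m <= TsK m }.

(** * States *)

Section States.
Variables (D : nat) (hD : (0 < D)%N).

Lemma slot_gt0 (s : state D) : (0 < slot s)%N.
Proof.
case: s => [[[t b] [|]]] /=; rewrite /slot /=; first by case/andP=> /ltnW.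
by case/andP.
Qed.

Lemma slot_le (s : state D) : (slot s <= D)%N.
Proof. by rewrite /slot -ltnS ltn_ord. Qed.

Lemma slot_start : slot (start hD) = 1%N. Proof. by []. Qed.

Lemma buffered_lt (s : state D) : (buffered s < slot s)%N.
Proof.
case: s => [[[t b] [|]]] /=; rewrite /slot /buffered /=.
  by case/andP=> t2 /eqP ->; apply: ltn_trans t2.
by case/andP; case: (nat_of_ord t).
Qed.

Lemma known_slot (s : state D) : known s -> (1 < slot s)%N.
Proof.
by case: s => [[[t b] k]] /=; rewrite /slot /known /= => + hk; rewrite hk => /andP[].
Qed.

Lemma state_eq (s s' : state D) :
  slot s = slot s' -> buffered s = buffered s' -> known s = known s' -> s = s'.
Proof.
move=> ht hb hk; apply: val_inj; move: ht hb hk; rewrite /slot /buffered /known.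
case: (val s) => [[t b] k]; case: (val s') => [[t' b'] k'] /=.
by move=> /val_inj -> /val_inj -> ->.
Qed.

Lemma known_buffered (s : state D) : known s -> buffered s = 0%N.
Proof.
by case: s => [[[t b] k]] /=; rewrite /buffered /known /= => + hk; rewrite hk => /andP[_ /eqP].
Qed.

Lemma at_U_uniq (s s' : state D) t b : at_U s t b -> at_U s' t b -> s = s'.
Proof.
case/and3P=> /eqP ht /eqP hb /negbTE hk /and3P[/eqP ht' /eqP hb' /negbTE hk'].
by apply: state_eq; rewrite ?ht ?hb ?hk.
Qed.

Lemma at_K_uniq (s s' : state D) t : at_K s t -> at_K s' t -> s = s'.
Proof.
case/andP=> /eqP ht hk /andP[/eqP ht' hk'].
by apply: state_eq; rewrite ?ht ?hk ?hk' ?(known_buffered hk) ?(known_buffered hk').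
Qed.

Lemma at_U_start (s : state D) : at_U s 1 0 = (s == start hD).
Proof.
apply/idP/eqP => [h|-> //].
by apply: (at_U_uniq h).
Qed.

Lemma at_U_ex t b : (0 < t)%N -> (t <= D)%N -> (b < t)%N ->
  exists s : state D, at_U s t b.
Proof.
move=> t0 tD bt; have bD : (b < D.+1)%N by apply: ltn_trans bt _.
have v : valid_state (@Ordinal D.+1 t tD, @Ordinal D.+1 b bD, false).
  by rewrite /= t0; case: (t) bt.
by exists (exist (@valid_state D) _ v); rewrite /at_U /slot /buffered /known /= !eqxx.
Qed.

Lemma at_K_ex t : (1 < t)%N -> (t <= D)%N -> exists s : state D, at_K s t.
Proof.
move=> t1 tD.
have v : @valid_state D (@Ordinal D.+1 t tD, ord0, true) by rewrite /= t1.
by exists (exist (@valid_state D) _ v); rewrite /at_K /slot /known /= eqxx.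
Qed.

(** Backward induction over slots: within a cycle every transition raises the slot. *)
Lemma slot_ind (P : state D -> Prop) :
  (forall s, (forall s', (slot s < slot s')%N -> P s') -> P s) ->
  forall s, P s.
Proof.
move=> IH s; have [n] := ubnP (D - slot s)%N.
elim: n s => [//|n IHn] s hn; apply: IH => s' hs; apply: IHn.
by rewrite -ltnS; apply: leq_trans hn; rewrite ltnS ltn_sub2l// (leq_trans hs (slot_le s')).
Qed.

End States.

(** * Reading a function at given state coordinates *)

Section Lookup.
Context {R : realType} {D : nat}.
Implicit Type h : state D -> R.

(* The value of [h] at (t, b, U), respectively (t, 0, K), and 0 if there is no
   such state. *)
Definition lookupU h (t b : nat) : R := \sum_(s : state D) (at_U s t b)%:R * h s.
Definition lookupK h (t : nat) : R := \sum_(s : state D) (at_K s t)%:R * h s.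

Lemma lookupU_at h s t b : at_U s t b -> lookupU h t b = h s.
Proof.
move=> hs; rewrite /lookupU (bigD1 s)//= hs mul1r big1 ?addr0// => s' ne.
case: (boolP (at_U s' t b)) => h'; last by rewrite mul0r.
by rewrite (at_U_uniq h' hs) eqxx in ne.
Qed.

Lemma lookupK_at h s t : at_K s t -> lookupK h t = h s.
Proof.
move=> hs; rewrite /lookupK (bigD1 s)//= hs mul1r big1 ?addr0// => s' ne.
case: (boolP (at_K s' t)) => h'; last by rewrite mul0r.
by rewrite (at_K_uniq h' hs) eqxx in ne.
Qed.

Lemma lookupU_out h t b : (D < t)%N -> lookupU h t b = 0.
Proof.
move=> tD; apply: big1 => s _; case: (boolP (at_U s t b)) => [/and3P[/eqP e _ _]|]; last by rewrite mul0r.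
by move: (slot_le s); rewrite e leqNgt tD.
Qed.

Lemma lookupK_out h t : (D < t)%N -> lookupK h t = 0.
Proof.
move=> tD; apply: big1 => s _; case: (boolP (at_K s t)) => [/andP[/eqP e _]|]; last by rewrite mul0r.
by move: (slot_le s); rewrite e leqNgt tD.
Qed.

Lemma eq_lookupU h h' t b : (forall s, slot s = t -> h s = h' s) ->
  lookupU h t b = lookupU h' t b.
Proof.
move=> hh; apply: eq_bigr => s _; case: (boolP (at_U s t b)); last by rewrite !mul0r.
by case/and3P => /eqP e _ _; rewrite hh.
Qed.

Lemma eq_lookupK h h' t : (forall s, slot s = t -> h s = h' s) ->
  lookupK h t = lookupK h' t.
Proof.
move=> hh; apply: eq_bigr => s _; case: (boolP (at_K s t)); last by rewrite !mul0r.
by case/andP => /eqP e _; rewrite hh.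
Qed.

End Lookup.

(** * One-step kernel and its cut at the start state *)

Section Kernel.
Context {R : realType}.
Variables (m : mdp_params R) (D : nat) (hD : (0 < D)%N).
Implicit Types (h : state D -> R) (s : state D) (a : action).

Lemma trans_sumE h s a : \sum_s' trans m s a s' * h s' =
  if slot s == D then lookupU h 1 0
  else if known s then (1 - qpp m a) * lookupU h 1 0 + qpp m a * lookupK h (slot s).+1
  else (1 - qpp m a) * lookupU h 1 0 + qpp m a * (1 - qps m a) * lookupK h (slot s).+1
    + match a with
      | Active => qpp m Active * pbuf m * lookupU h (slot s).+1 (buffered s).+1
          + qpp m Active * (qps m Active - pbuf m) * lookupU h (slot s).+1 (buffered s)
      | Idle => qpp m Idle * qps m Idle * lookupU h (slot s).+1 (buffered s)
      end.
Proof.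
rewrite /trans; case: ifP => // _; case: ifP => _.
  rewrite /lookupU /lookupK !mulr_sumr -big_split; apply: eq_bigr => s' _ /=.
  by rewrite mulrDl -!mulrA.
case: a; rewrite /lookupU /lookupK !mulr_sumr -?big_split; apply: eq_bigr => s' _ /=;
by rewrite !mulrDl -!mulrA.
Qed.

(* The cycle is cut at the returns to the start state. *)
Definition onward h s a : R :=
  \sum_s' trans m s a s' * (h s' *+ (s' != start hD)).

Lemma onwardE h s a : onward h s a =
  if known s then qpp m a * lookupK h (slot s).+1
  else qpp m a * (1 - qps m a) * lookupK h (slot s).+1
    + match a with
      | Active => qpp m Active * pbuf m * lookupU h (slot s).+1 (buffered s).+1
          + qpp m Active * (qps m Active - pbuf m) * lookupU h (slot s).+1 (buffered s)
      | Idle => qpp m Idle * qps m Idle * lookupU h (slot s).+1 (buffered s)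
      end.
Proof.
rewrite /onward trans_sumE.
have -> : lookupU (fun s' => h s' *+ (s' != start hD)) 1 0 = 0.
  apply: big1 => s' _; rewrite (at_U_start hD).
  by case: eqP => _; rewrite ?mulr0 ?mul0r.
have eU b : lookupU (fun s' => h s' *+ (s' != start hD)) (slot s).+1 b = lookupU h (slot s).+1 b.
  apply: eq_lookupU => s' hs'; case: eqP => // e.
  by move: (slot_gt0 s) hs'; rewrite e slot_start; case: (slot s).
have eK : lookupK (fun s' => h s' *+ (s' != start hD)) (slot s).+1 = lookupK h (slot s).+1.
  apply: eq_lookupK => s' hs'; case: eqP => // e.
  by move: (slot_gt0 s) hs'; rewrite e slot_start; case: (slot s).
rewrite eK !eU !mulr0 !add0r; case: eqP => // ->.
(* Lookups at slot [D.+1] vanish, so one formula also covers the last slot. *)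
by rewrite lookupK_out// !lookupU_out// !mulr0 !add0r; case: ifP => //; case: a; rewrite ?addr0.
Qed.

Lemma trans_onward h s a : h (start hD) = 0 ->
  \sum_s' trans m s a s' * h s' = onward h s a.
Proof.
move=> h0; apply: eq_bigr => s' _; case: eqP => [->|//].
by rewrite h0.
Qed.

Lemma eq_onward h h' s a :
  (forall s', (slot s < slot s')%N -> h s' = h' s') -> onward h s a = onward h' s a.
Proof.
move=> hh; rewrite !onwardE.
have eU b : lookupU h (slot s).+1 b = lookupU h' (slot s).+1 b.
  by apply: eq_lookupU => s' e; apply: hh; rewrite e.
have eK : lookupK h (slot s).+1 = lookupK h' (slot s).+1.
  by apply: eq_lookupK => s' e; apply: hh; rewrite e.
by rewrite eK !eU.
Qed.

Lemma onwardD h h' s a : onward (fun s' => h s' + h' s') s a = onward h s a + onward h' s a.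
Proof.
rewrite /onward -big_split; apply: eq_bigr => s' _ /=.
by rewrite mulrnDl mulrDr.
Qed.

Lemma onwardZ c h s a : onward (fun s' => c * h s') s a = c * onward h s a.
Proof.
rewrite /onward mulr_sumr; apply: eq_bigr => s' _ /=.
by rewrite mulrCA -mulrnAr.
Qed.

Lemma onward0 s a : onward (fun=> 0) s a = 0.
Proof. by apply: big1 => s' _; rewrite mul0rn mulr0. Qed.

Lemma cvg_onward (T : Type) (F : set_system T) (FF : Filter F)
    (hs : T -> state D -> R) h s a :
  (forall s, hs t s @[t --> F] --> h s) -> onward (hs t) s a @[t --> F] --> onward h s a.
Proof.
move=> ch; rewrite /onward; apply: cvg_big => [|s' _]; first exact: add_continuous.
apply: cvgM; first exact: cvg_cst.
by case: (s' != start hD); [exact: ch|exact: cvg_cst].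
Qed.

Hypothesis hm : admissible m.

Lemma trans_ge0 s a s' : 0 <= trans m s a s'.
Proof.
have /andP[q0 q1] := qpp_itv hm a; have /andP[q0' q1'] := qpp_itv hm Idle.
have /andP[p0 p1] := qps_itv hm a; have /andP[p0' p1'] := qps_itv hm Idle.
have /andP[b0 b1] := pbuf_itv hm.
rewrite /trans; case: ifP => // _; case: ifP => _; last case: a q0 q1 p0 p1 => *.
- by rewrite addr_ge0// mulr_ge0// ?subr_ge0 ltW.
- by rewrite !addr_ge0// ?mulr_ge0// ?subr_ge0// ltW.
- by rewrite !addr_ge0// ?mulr_ge0// ?subr_ge0// ltW.
Qed.

Lemma le_onward h h' s a :
  (forall s', (slot s < slot s')%N -> h s' <= h' s') -> onward h s a <= onward h' s a.
Proof.
move=> hh.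
(* [onward] sees only later slots, so [h] may be replaced by [k], which is at most [h'] everywhere
   and allows a termwise comparison. *)
pose k s' := if (slot s < slot s')%N then h s' else h' s'.
rewrite (@eq_onward h k); last by move=> s' e; rewrite /k e.
apply: ler_sum => s' _; apply: ler_wpM2l; first exact: trans_ge0.
by apply: ler_wMn2r; rewrite /k; case: ifP => // /hh.
Qed.

Lemma trans_sum1 s a : \sum_s' trans m s a s' = 1.
Proof.
have [u hu] := @at_U_ex D 1 0 isT hD isT.
under eq_bigr => s' _ do rewrite -[trans m s a s']mulr1.
rewrite trans_sumE (lookupU_at _ hu).
case: eqP => // /eqP nD.
have sD : (slot s < D)%N by rewrite ltn_neqAle nD slot_le.
have [v hv] := @at_K_ex D (slot s).+1 (slot_gt0 s) sD.
rewrite (lookupK_at _ hv) !mulr1.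
case: ifP => ks; first by rewrite subrK.
have [w hw] := @at_U_ex D (slot s).+1 (buffered s) isT sD (leqW (buffered_lt s)).
have [x hx] := @at_U_ex D (slot s).+1 (buffered s).+1 isT sD (buffered_lt s).
by rewrite (lookupU_at _ hw) (lookupU_at _ hx); case: a; ring.
Qed.

End Kernel.

(** * Cycle values *)

Section Cycle.
Context {R : realType}.
Variables (m : mdp_params R) (D : nat) (hD : (0 < D)%N).
Local Notation policy := (state D -> R).
Local Notation reward := (state D -> action -> R).
Local Notation z := (start hD).
Local Notation onward := (@onward _ m D hD).
Implicit Types (f g : reward) (mu nu : policy) (h : state D -> R) (s : state D).

Fixpoint cycle_iter f mu n s : R :=
  if n is n'.+1 then
    average_action mu s (fun a => f s a + onward (cycle_iter f mu n') s a)
  else 0.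

(* Expected total reward up to the next return to the start state; [D] steps
   suffice because the slot increases until then. *)
Definition cycle_value f mu : state D -> R := cycle_iter f mu D.
Local Notation V := cycle_value.

Definition action_value f mu s a : R := f s a + onward (V f mu) s a.

Definition advantage f mu s : R :=
  action_value f mu s Active - action_value f mu s Idle.

(** Its cycle value is the expected cycle length. *)
Definition unit_reward : reward := fun _ _ => 1.

(** From the start state its cycle value is the probability that a cycle visits [s]. *)
Definition visits s : reward := fun s' _ => (s' == s)%:R.

(** The renewal-reward ratio, identified with the long-run average in [long_run_averageE]. *)
Definition cycle_gain f mu : R := V f mu z / V unit_reward mu z.

Lemma cycle_iterS f mu n s : (D < slot s + n)%N ->
  cycle_iter f mu n s = cycle_iter f mu n.+1 s.
Proof.
elim: n s => [|n IH] s hs.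
  by move: (slot_le s); rewrite leqNgt -[slot s]addn0 hs.
rewrite /= /average_action.
have e a : onward (cycle_iter f mu n) s a = onward (cycle_iter f mu n.+1) s a.
  apply: eq_onward => s' hs'; apply: IH; apply: leq_trans hs _.
  by rewrite addnS -addSn leq_add2r.
by rewrite !e.
Qed.

Lemma cycle_valueE f mu s : V f mu s = average_action mu s (action_value f mu s).
Proof. by rewrite /V cycle_iterS// -{1}[D]add0n ltn_add2r slot_gt0. Qed.

(** The Bellman equation is acyclic in the slot, so it determines its solution; identities between
    cycle values are proved by checking this equation. *)
Lemma cycle_value_uniq f mu h :
  (forall s, h s = average_action mu s (fun a => f s a + onward h s a)) ->
  forall s, h s = V f mu s.
Proof.
move=> hh; apply: slot_ind => s IH; rewrite hh cycle_valueE.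
rewrite /average_action /action_value.
by rewrite !(@eq_onward _ _ _ _ h (V f mu)).
Qed.

Lemma eq_cycle_value f g mu s : (forall s a, f s a = g s a) -> V f mu s = V g mu s.
Proof.
move=> fg; apply: cycle_value_uniq => {}s.
by rewrite cycle_valueE /average_action /action_value !fg.
Qed.

Lemma cycle_valueD c f g mu s :
  V (fun s a => f s a + c * g s a) mu s = V f mu s + c * V g mu s.
Proof.
apply/esym; apply: (cycle_value_uniq (h := fun s => V f mu s + c * V g mu s)) => {}s.
rewrite !cycle_valueE /average_action /action_value !onwardD !onwardZ.
by ring.
Qed.

Lemma advantageD c f g mu s :
  advantage (fun s a => f s a + c * g s a) mu s =
  advantage f mu s + c * advantage g mu s.
Proof.
rewrite /advantage /action_value.
have e a : onward (V (fun s a => f s a + c * g s a) mu) s a =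
    onward (fun s => V f mu s + c * V g mu s) s a.
  by apply: eq_onward => s' _; rewrite cycle_valueD.
by rewrite !e !onwardD !onwardZ; ring.
Qed.

Lemma cycle_value_visits_out s mu s' : (slot s < slot s')%N ->
  V (visits s) mu s' = 0.
Proof.
move: s'; apply: slot_ind => s' IH lt_s.
rewrite cycle_valueE /average_action /action_value.
have e a : onward (V (visits s) mu) s' a = onward (fun=> 0) s' a.
  by apply: eq_onward => x hx; apply: IH => //; apply: ltn_trans hx.
rewrite !e !onward0 /visits; case: eqP => [es|_] /=; last by ring.
by rewrite es ltnn in lt_s.
Qed.

(* A cycle visits [s] at most once, so cycle values are affine in the
   coordinate [mu s]. *)
Lemma cycle_value_shift f mu s x s' :
  V f (Defs.shift mu s x) s' =
  V f mu s' + x * advantage f mu s * V (visits s) mu s'.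
Proof.
apply/esym; move: s'; apply: cycle_value_uniq => s'.
rewrite [in LHS]cycle_valueE [V (visits s) mu s']cycle_valueE.
rewrite /average_action /action_value !onwardD !onwardZ.
rewrite /Defs.shift {1 3}/visits; case: eqP => [->|_] /=; last by ring.
have e a : onward (V (visits s) mu) s a = onward (fun=> 0) s a.
  by apply: eq_onward => x' hx'; apply: cycle_value_visits_out.
rewrite !e !onward0 /advantage /action_value; ring.
Qed.

(** By [cycle_value_shift], changing [mu s] at zero advantage changes no cycle value. *)
Lemma advantage_shift f mu s x s' :
  advantage f mu s = 0 -> advantage f (Defs.shift mu s x) s' = advantage f mu s'.
Proof.
move=> a0; rewrite /advantage /action_value.
have e a : onward (V f (Defs.shift mu s x)) s' a = onward (V f mu) s' a.
  by apply: eq_onward => s'' _; rewrite cycle_value_shift a0; ring.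
by rewrite !e.
Qed.

Lemma cycle_gainD c f g mu :
  cycle_gain (fun s a => f s a + c * g s a) mu = cycle_gain f mu + c * cycle_gain g mu.
Proof. by rewrite /cycle_gain cycle_valueD mulrDl mulrA. Qed.

Lemma cvg_cycle_value (T : Type) (F : set_system T) (FF : Filter F)
    (mus : T -> policy) mu f s :
  (forall s, mus t s @[t --> F] --> mu s) -> V f (mus t) s @[t --> F] --> V f mu s.
Proof.
move=> cmu.
suff c n : forall s, cycle_iter f (mus t) n s @[t --> F] --> cycle_iter f mu n s.
  exact: c.
elim: n => [|n IH] {}s /=; first exact: cvg_cst.
apply: cvgD; apply: cvgM.
- exact: cmu.
- by apply: cvgD; [exact: cvg_cst|exact: cvg_onward].
- by apply: cvgB; [exact: cvg_cst|exact: cmu].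
- by apply: cvgD; [exact: cvg_cst|exact: cvg_onward].
Qed.

Lemma cvg_advantage (T : Type) (F : set_system T) (FF : Filter F)
    (mus : T -> policy) mu f s :
  (forall s, mus t s @[t --> F] --> mu s) ->
  advantage f (mus t) s @[t --> F] --> advantage f mu s.
Proof.
move=> cmu; apply: cvgB; apply: cvgD; first exact: cvg_cst.
- by apply: cvg_onward => s'; exact: cvg_cycle_value.
- exact: cvg_cst.
- by apply: cvg_onward => s'; exact: cvg_cycle_value.
Qed.

(** * Comparison of cycle values and gains *)

Hypothesis hm : admissible m.

Lemma average_action_le mu s (p q : action -> R) : is_policy mu ->
  (forall a, p a <= q a) -> average_action mu s p <= average_action mu s q.
Proof.
move=> /(_ s) /andP[m0 m1] pq.
by apply: lerD; apply: ler_wpM2l; rewrite ?subr_ge0.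
Qed.

(** A supersolution of the Bellman equation dominates the value, by backward induction; gain bounds
    then come from trial functions [h]. *)
Lemma cycle_value_le f mu h : is_policy mu ->
  (forall s, average_action mu s (fun a => f s a + onward h s a) <= h s) ->
  forall s, V f mu s <= h s.
Proof.
move=> hmu hh; apply: slot_ind => s IH.
apply: le_trans (hh s); rewrite cycle_valueE; apply: average_action_le => // a.
by rewrite lerD2l; apply: le_onward.
Qed.

Lemma cycle_value_mono f g mu s : is_policy mu -> (forall s a, f s a <= g s a) ->
  V f mu s <= V g mu s.
Proof.
move=> hmu fg; apply: cycle_value_le => // {}s; rewrite cycle_valueE.
by apply: average_action_le => // a; rewrite lerD2r.
Qed.

Lemma cycle_value_ge0 f mu s : is_policy mu -> (forall s a, 0 <= f s a) ->
  0 <= V f mu s.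
Proof.
move=> hmu f0; apply: le_trans (cycle_value_mono s hmu f0).
rewrite -(@cycle_value_uniq _ _ (fun=> 0))// => s'.
by rewrite /average_action !onward0; ring.
Qed.

Lemma cycle_length_ge1 mu s : is_policy mu -> 1 <= V unit_reward mu s.
Proof.
move=> hmu; rewrite cycle_valueE.
apply: (@le_trans _ _ (average_action mu s (fun=> 1))).
  by rewrite /average_action -mulrDl addrC subrK mul1r.
apply: average_action_le => // a; rewrite lerDl -(onward0 m hD s a).
by apply: le_onward => // s' _; apply: cycle_value_ge0.
Qed.

Lemma cycle_length_gt0 mu s : is_policy mu -> 0 < V unit_reward mu s.
Proof. by move=> hmu; apply: lt_le_trans (cycle_length_ge1 s hmu). Qed.

Lemma cycle_value_centered f mu c s :
  V (fun s a => f s a - c) mu s = V f mu s - c * V unit_reward mu s.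
Proof.
rewrite -mulNr -cycle_valueD; apply: eq_cycle_value => s' a.
by rewrite mulr1.
Qed.

Lemma cycle_gain_le f mu c : is_policy mu ->
  V (fun s a => f s a - c) mu z <= 0 -> cycle_gain f mu <= c.
Proof.
move=> hmu; rewrite cycle_value_centered subr_le0.
by rewrite /cycle_gain ler_pdivrMr ?cycle_length_gt0.
Qed.

Lemma cycle_value_gain f mu : is_policy mu ->
  V (fun s a => f s a - cycle_gain f mu) mu z = 0.
Proof.
move=> hmu; rewrite cycle_value_centered /cycle_gain divfK ?subrr//.
by rewrite gt_eqF ?cycle_length_gt0.
Qed.

Lemma cycle_gain_uniq f mu c : is_policy mu ->
  V (fun s a => f s a - c) mu z = 0 -> cycle_gain f mu = c.
Proof.
move=> hmu; rewrite cycle_value_centered => /eqP; rewrite subr_eq0 => /eqP e.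
by rewrite /cycle_gain e mulfK// gt_eqF ?cycle_length_gt0.
Qed.

(** Policy comparison: the centered values of [mu] form a supersolution for [nu], and they vanish at
    the start state. *)
Lemma gain_le_of_advantage f mu nu : is_policy mu -> is_policy nu ->
  (forall s, (nu s - mu s) * advantage (fun s a => f s a - cycle_gain f mu) mu s <= 0) ->
  cycle_gain f nu <= cycle_gain f mu.
Proof.
move=> hmu hnu hadv; apply: cycle_gain_le => //.
rewrite -(cycle_value_gain f hmu).
apply: cycle_value_le => // s; rewrite [leRHS]cycle_valueE -subr_le0.
apply: le_trans (hadv s); rewrite /advantage /average_action /action_value le_eqVlt.
by apply/orP; left; apply/eqP; ring.
Qed.

End Cycle.

(** * Long-run averages and the efficiency *)

Section Average.
Context {R : realType}.
Variables (m : mdp_params R) (D : nat) (hD : (0 < D)%N).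
Hypothesis hm : admissible m.
Local Notation policy := (state D -> R).
Local Notation reward := (state D -> action -> R).
Local Notation z := (start hD).
Local Notation V := (cycle_value m hD).
Local Notation gain := (cycle_gain m hD).
Local Notation law := (state_law m).
Implicit Types (f : reward) (mu nu : policy) (s : state D).

Lemma average_trans_ge0 mu s s' : is_policy mu ->
  0 <= average_action mu s (fun a => trans m s a s').
Proof.
move=> /(_ s)/andP[m0 m1].
by rewrite addr_ge0// mulr_ge0 ?trans_ge0// subr_ge0.
Qed.

Lemma state_law_ge0 mu s0 n s : is_policy mu -> 0 <= law mu s0 n s.
Proof.
move=> hmu; elim: n s => [|n IH] s /=; first exact: ler0n.
by apply: sumr_ge0 => s' _; rewrite mulr_ge0// average_trans_ge0.
Qed.

Lemma state_law_sum1 mu s0 n : \sum_s law mu s0 n s = 1.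
Proof.
elim: n => [|n IH] /=.
  rewrite (bigD1 s0)//= eqxx big1 ?addr0// => s /negbTE -> //.
rewrite exchange_big /= -[RHS]IH; apply: eq_bigr => s _.
rewrite -mulr_sumr -[RHS]mulr1; congr (_ * _).
by rewrite big_split -!mulr_sumr !trans_sum1//= !mulr1 addrC subrK.
Qed.

Lemma state_law_le1 mu s0 n s : is_policy mu -> law mu s0 n s <= 1.
Proof.
move=> hmu; rewrite -(state_law_sum1 mu s0 n) (bigD1 s)//= lerDl.
by apply: sumr_ge0 => s' _; exact: state_law_ge0.
Qed.

(** The relative value function of average-reward theory, normalized to vanish at the start
    state. *)
Definition bias f mu : state D -> R := V (fun s a => f s a - gain f mu) mu.

(** Since [bias] is 0 at the start state, the cut transitions in its Bellman equation may be
    replaced by the full kernel. *)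
Lemma poisson f mu s : is_policy mu ->
  average_action mu s (f s) = gain f mu + bias f mu s
    - \sum_s' average_action mu s (fun a => trans m s a s') * bias f mu s'.
Proof.
move=> hmu; rewrite {1}/bias cycle_valueE /action_value.
have e a : onward m hD (bias f mu) s a = \sum_s' trans m s a s' * bias f mu s'.
  by rewrite (@trans_onward _ m D hD) // /bias cycle_value_gain.
have -> : \sum_s' average_action mu s (fun a => trans m s a s') * bias f mu s' =
    average_action mu s (onward m hD (bias f mu) s).
  rewrite /average_action !e !mulr_sumr -big_split; apply: eq_bigr => s' _ /=.
  by rewrite mulrDl !mulrA.
by rewrite -/(bias f mu) /average_action; ring.
Qed.

Lemma expected_reward_telescope f mu s0 N : is_policy mu ->
  \sum_(n < N) expected_reward m f mu s0 n =
  N%:R * gain f mu + bias f mu s0 - \sum_s law mu s0 N s * bias f mu s.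
Proof.
move=> hmu; elim: N => [|N IH].
  rewrite big_ord0 mul0r add0r (bigD1 s0)//= eqxx mul1r big1 ?addr0 ?subrr//.
  by move=> s /negbTE ->; rewrite mul0r.
rewrite big_ord_recr /= {}IH /expected_reward.
under [X in _ + X]eq_bigr do rewrite poisson// mulrBr mulrDr.
rewrite sumrB big_split/= -mulr_suml state_law_sum1.
have -> : \sum_s law mu s0 N s *
      (\sum_s' average_action mu s (fun a => trans m s a s') * bias f mu s') =
    \sum_s' (\sum_s law mu s0 N s * average_action mu s (fun a => trans m s a s'))
      * bias f mu s'.
  under eq_bigr do rewrite mulr_sumr.
  rewrite exchange_big; apply: eq_bigr => s' _ /=.
  by rewrite mulr_suml; apply: eq_bigr => s _; rewrite mulrA.
by rewrite -natr1; ring.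
Qed.

(** In the telescoped Poisson equation the boundary terms are bounded uniformly in time, so dividing
    by the number of slots removes them. *)
Lemma long_run_averageE f s0 mu : is_policy mu ->
  long_run_average m f s0 mu = gain f mu.
Proof.
move=> hmu; apply/cvg_lim; first exact: norm_hausdorff.
pose B := `|bias f mu s0| + \sum_s `|bias f mu s|.
(* Starting the averages at one slot avoids the inverse of 0 and makes the error a multiple of
   [harmonic]. *)
rewrite -cvg_shiftS.
have hb N : `|bias f mu s0 - \sum_s law mu s0 N s * bias f mu s| <= B.
  apply: le_trans (ler_normB _ _) _; rewrite lerD2l.
  apply: le_trans (ler_norm_sum _ _ _) _; apply: ler_sum => s _.
  rewrite normrM ger0_norm ?state_law_ge0//.
  by apply: ler_piMl => //; apply: state_law_le1.
have cB (b : R) : gain f mu + b * harmonic n @[n --> \oo] --> gain f mu.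
  rewrite -[X in _ --> X]addr0; apply: cvgD; first exact: cvg_cst.
  rewrite -[X in _ --> X](mulr0 b); apply: cvgM; first exact: cvg_cst.
  exact: cvg_harmonic.
apply: squeeze_cvgr (cB (- B)) (cB B).
near=> N; rewrite /= expected_reward_telescope// /harmonic /=.
have := hb N.+1; rewrite ler_norml => /andP[h1 h2].
have N0 : (0 : R) < N.+1%:R by rewrite ltr0Sn.
have -> : N.+1%:R^-1 * (N.+1%:R * gain f mu + bias f mu s0
      - \sum_s law mu s0 N.+1 s * bias f mu s) = gain f mu +
    (bias f mu s0 - \sum_s law mu s0 N.+1 s * bias f mu s) * N.+1%:R^-1.
  by rewrite -addrA mulrDr mulKf ?gt_eqF// [X in _ + X = _]mulrC.
by rewrite !lerD2l; apply/andP; split; apply: ler_wpM2r => //; rewrite invr_ge0 ltW.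
Unshelve. all: by end_near. Qed.

(** If cycles missed [s], the gain of [visits s] would be 0 and its bias nonnegative; the telescoped
    sum would then force every [law mu z n s] to be 0. *)
Lemma accessible_visits_gt0 mu s : is_policy mu -> accessible m mu z s ->
  0 < V (visits s) mu z.
Proof.
move=> hmu [n hn]; rewrite lt_neqAle (@cycle_value_ge0 _ _ _ hD hm) ?andbT//.
apply/eqP => /esym v0.
have g0 : gain (visits s) mu = 0 by rewrite /cycle_gain v0 mul0r.
have hb s' : 0 <= bias (visits s) mu s'.
  by apply: cycle_value_ge0 => // *; rewrite g0 subr0 /visits ler0n.
have := expected_reward_telescope (visits s) z n.+1 hmu.
have -> : bias (visits s) mu z = 0 by rewrite /bias cycle_value_gain.
rewrite g0 mulr0 add0r sub0r.
have er k : expected_reward m (visits s) mu z k = law mu z k s.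
  rewrite /expected_reward (bigD1 s)//= big1 ?addr0.
    by rewrite /average_action /visits eqxx /=; ring.
  move=> s' /negbTE ne; rewrite /average_action /visits ne /=; ring.
rewrite big_ord_recr /= er => e.
have : 0 < - (\sum_s' law mu z n.+1 s' * bias (visits s) mu s').
  rewrite -e ltr_wpDl// sumr_ge0// => k _; rewrite er.
  exact: state_law_ge0.
rewrite oppr_gt0 ltNge sumr_ge0// => s' _.
by rewrite mulr_ge0// state_law_ge0.
Qed.

(** * Perturbed policies, partial derivatives and the efficiency *)

Lemma is_policy_mix (l : R) mu nu : 0 <= l <= 1 -> is_policy mu -> is_policy nu ->
  is_policy (mix l mu nu).
Proof.
move=> /andP[l0 l1] hmu hnu s; rewrite /mix.
have /andP[a0 a1] := hmu s; have /andP[b0 b1] := hnu s.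
apply/andP; split; first by rewrite addr_ge0 ?mulr_ge0 ?subr_ge0.
by nra.
Qed.

(** In each slot the mixture follows [nu] with weight [v], hence one factor [v] per slot. *)
Lemma state_law_mix (v : R) mu nu s0 n s : 0 <= v <= 1 -> is_policy mu ->
  is_policy nu -> v ^+ n * law nu s0 n s <= law (mix (1 - v) mu nu) s0 n s.
Proof.
move=> /andP[v0 v1] hmu hnu; elim: n s => [|n IH] s /=; first by rewrite expr0 mul1r.
rewrite mulr_sumr; apply: ler_sum => s' _.
have -> : v ^+ n.+1 * (law nu s0 n s' * average_action nu s' (fun a => trans m s' a s)) =
  (v ^+ n * law nu s0 n s') * (v * average_action nu s' (fun a => trans m s' a s)).
  by rewrite exprS; ring.
apply: ler_pM => //.
- by rewrite mulr_ge0 ?exprn_ge0 ?state_law_ge0.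
- by rewrite mulr_ge0 ?average_trans_ge0.
have -> : average_action (mix (1 - v) mu nu) s' (fun a => trans m s' a s) =
   v * average_action nu s' (fun a => trans m s' a s) +
   (1 - v) * average_action mu s' (fun a => trans m s' a s).
  by rewrite /average_action /mix; ring.
by rewrite lerDl mulr_ge0 ?average_trans_ge0// subr_ge0.
Qed.

Lemma accessible_mix (v : R) mu nu s0 s : 0 < v <= 1 -> is_policy mu ->
  is_policy nu -> accessible m nu s0 s -> accessible m (mix (1 - v) mu nu) s0 s.
Proof.
move=> /andP[v0 v1] hmu hnu [n hn]; exists n.
apply: lt_le_trans (state_law_mix _ _ _ _ hmu hnu); last by rewrite (ltW v0).
by rewrite mulr_gt0 ?exprn_gt0.
Qed.

(** The advantage in the average-reward sense: each slot is charged the gain. *)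
Definition net f mu s : R := advantage m hD (fun s a => f s a - gain f mu) mu s.

Lemma netE f mu s : net f mu s =
  advantage m hD f mu s - gain f mu * advantage m hD (unit_reward (D:=D)) mu s.
Proof.
rewrite -mulNr -advantageD /net; congr (advantage _ _ _ _ _).
by apply/funext => s'; apply/funext => a; rewrite mulr1.
Qed.

Lemma is_policy_shift mu s h : is_policy mu -> 0 <= mu s + h <= 1 ->
  is_policy (Defs.shift mu s h).
Proof.
move=> hmu hs s'; rewrite /Defs.shift; case: eqP => [->|_]; first by rewrite mulr1.
by rewrite mulr0 addr0.
Qed.

(** Properness of the filter in [partial] makes its limit unique: from [x] at most 1/2 one can step
    up, otherwise down. *)
Lemma proper_unit_increment (x : R) : 0 <= x <= 1 ->
  ProperFilter (within [set h : R | 0 <= x + h <= 1] 0^').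
Proof.
move=> /andP[x0 x1]; apply: Build_ProperFilter_ex => // A.
rewrite /within /= => /nbhs_ballP[e /= e0 he].
pose d := Num.min (e / 2) (2^-1).
have d0 : 0 < d by rewrite lt_min divr_gt0//= invr_gt0.
have de : d < e by rewrite gt_min ltr_pdivrMr// ltr_pMr// ltr1n.
have d1 : d <= 2^-1 by rewrite ge_min lexx orbT.
case: (lerP x (2^-1)) => hx.
- exists d; apply: he; rewrite /ball /=.
  + by rewrite sub0r normrN gtr0_norm.
  + by rewrite gt_eqF.
  + by apply/andP; split; lra.
- exists (- d); apply: he; rewrite /ball /=.
  + by rewrite sub0r opprK gtr0_norm.
  + by rewrite oppr_eq0 gt_eqF.
  + by apply/andP; split; lra.
Qed.

(** Numerator and denominator of the gain are affine in [mu s] with the common factor [p], the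
    chance of visiting [s], so the difference quotient is explicit. *)
Lemma partialE f s0 mu s : is_policy mu ->
  partial (long_run_average m f s0) s mu =
  V (visits s) mu z / V (unit_reward (D:=D)) mu z * net f mu s.
Proof.
move=> hmu; rewrite /partial.
have PF := proper_unit_increment (hmu s).
apply/cvg_lim; first exact: norm_hausdorff.
set p := V (visits s) mu z; set L := V (unit_reward (D:=D)) mu z.
set aL := advantage m hD (unit_reward (D:=D)) mu s.
have L0 : L != 0 by rewrite gt_eqF// cycle_length_gt0.
have cL : p / (L + h * (aL * p)) * net f mu s @[h --> 0] --> p / L * net f mu s.
  apply: cvgM; last exact: cvg_cst.
  apply: cvgM; first exact: cvg_cst.
  apply: cvgV => //; rewrite -[X in _ --> X]addr0; apply: cvgD; first exact: cvg_cst.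
  by rewrite -[X in _ --> X](mul0r (aL * p)); apply: cvgM; [exact: cvg_id|exact: cvg_cst].
have {}cL : p / (L + h * (aL * p)) * net f mu s
    @[h --> within [set h : R | 0 <= mu s + h <= 1] 0^'] --> p / L * net f mu s.
  apply: cvg_within_filter; exact: cvg_within_filter cL.
apply: cvg_trans cL; apply: near_eq_cvg.
rewrite near_withinE; near=> h => hs.
have h0 : h != 0 by near: h; exact: nbhs_dnbhs_neq.
have hsh := is_policy_shift hmu hs.
rewrite !long_run_averageE// netE /cycle_gain !cycle_value_shift -/p -/L -/aL.
have Lh : L + h * aL * p != 0.
  by rewrite /L /aL /p -cycle_value_shift gt_eqF// cycle_length_gt0.
by rewrite (mulrA h aL p); field; apply/and3P; split.
Unshelve. all: by end_near. Qed.

Lemma cvg_net (T : Type) (F : set_system T) (FF : Filter F)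
    (mus : T -> policy) f mu s : is_policy mu ->
  (forall s, mus t s @[t --> F] --> mu s) ->
  net f (mus t) s @[t --> F] --> net f mu s.
Proof.
move=> hmu cmu; under eq_cvg do rewrite netE.
rewrite netE; apply: cvgB; first exact: cvg_advantage.
apply: cvgM; last exact: cvg_advantage.
apply: cvgM; first exact: cvg_cycle_value.
by apply: cvgV; [rewrite gt_eqF// cycle_length_gt0|exact: cvg_cycle_value].
Qed.

(** Under the perturbed policy [s] is visited with positive probability, so the visit rate cancels
    from the quotient of derivatives; what remains is continuous at [v = 0]. *)
Lemma efficiencyE s0 nu mu s : is_policy mu -> is_policy nu ->
  accessible m nu z s -> net (access (R:=R) (D:=D)) mu s != 0 ->
  efficiency m s0 nu mu s = net (throughput m (D:=D)) mu s / net (access (R:=R) (D:=D)) mu s.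
Proof.
move=> hmu hnu hacc hW; rewrite /efficiency; apply/cvg_lim; first exact: norm_hausdorff.
have cm s' : mix (1 - v) mu nu s' @[v --> 0^'+] --> mu s'.
  apply: cvg_at_right_filter; rewrite /mix.
  rewrite -[X in _ --> X]addr0; apply: cvgD.
    rewrite -[X in _ --> X]mul1r; apply: cvgM; last exact: cvg_cst.
    by rewrite -[X in _ --> X]subr0; apply: cvgB; [exact: cvg_cst|exact: cvg_id].
  rewrite -[X in _ --> X](mul0r (nu s')); apply: cvgM; last exact: cvg_cst.
  under eq_cvg do rewrite subKr.
  exact: cvg_id.
have cr : net (throughput m (D:=D)) (mix (1 - v) mu nu) s
    / net (access (R:=R) (D:=D)) (mix (1 - v) mu nu) s @[v --> 0^'+] -->
    net (throughput m (D:=D)) mu s / net (access (R:=R) (D:=D)) mu s.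
  apply: cvgM; first exact: cvg_net.
  by apply: cvgV => //; exact: cvg_net.
apply: cvg_trans cr; apply: near_eq_cvg; near=> v => /=.
have v0 : 0 < v by near: v; exact: nbhs_right_gt.
have v1 : v <= 1 by near: v; apply: nbhs_right_le.
have hv : is_policy (mix (1 - v) mu nu).
  by apply: is_policy_mix => //; apply/andP; split; lra.
have hp : 0 < V (visits s) (mix (1 - v) mu nu) z.
  by apply: accessible_visits_gt0 => //; apply: accessible_mix; rewrite ?v0.
rewrite !partialE//.
have c0 : V (visits s) (mix (1 - v) mu nu) z / V (unit_reward (D:=D)) (mix (1 - v) mu nu) z != 0.
  by rewrite gt_eqF// divr_gt0// cycle_length_gt0.
by rewrite -mulf_div divff// mul1r.
Unshelve. all: by end_near. Qed.

End Average.

(** * Access advantage and throughput per access *)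

(** Backward in time, [u] iterates a monotone affine map from 0, and the first step goes up because
    [0 <= c]. *)
Lemma backward_monotone (R : realDomainType) (D : nat) (c q : R) (u : nat -> R) :
  0 <= c -> 0 <= q -> (forall t, (D < t)%N -> u t = 0) ->
  (forall t, (1 < t <= D)%N -> u t = c + q * u t.+1) ->
  forall t, (1 < t)%N -> 0 <= u t.+1 <= u t.
Proof.
move=> c0 q0 uD ut t; have [n] : exists n, (D < t + n)%N by exists D.+1; rewrite addnS ltnS leq_addl.
elim: n t => [|n IH] t.
  by rewrite addn0 => tD _; rewrite !uD ?lexx// ltnW.
move=> hn t1; case: (ltnP D t) => tD; first by rewrite !uD ?lexx// ltnW.
have /andP[h0 h1] : 0 <= u t.+2 <= u t.+1.
  by apply: IH; rewrite ?(ltn_trans t1)// addSnnS.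
have h2 : 0 <= u t.+1 by apply: le_trans h1.
rewrite h2 /= (ut t) ?t1//.
case: (ltnP D t.+1) => tD1; first by rewrite uD// mulr0 addr0.
have e : u t.+1 = c + q * u t.+2 by apply: ut; rewrite tD1 andbT ltnW.
by rewrite {1}e lerD2l ler_wpM2l.
Qed.

(* [E t + r * g t.+1 b] and [P * g t.+1 b.+1 + S * g t.+1 b] are the deficits of
   being idle and active at (t, b, U) relative to (t, 0, K). *)
Lemma active_deficit_lt_idle (R : realFieldType) (D : nat) (E : nat -> R)
    (g : nat -> nat -> R) (P S r : R) :
  0 <= P -> 0 <= S -> 0 <= r -> P + S < 1 ->
  (forall t, (0 < t)%N -> 0 < E t.+1 <= E t) ->
  (forall t b, (D < t)%N -> g t b = 0) ->
  (forall t b, (1 < t <= D)%N -> (b < t)%N -> exists2 l, 0 <= l <= 1 &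
     g t b = l * (P * g t.+1 b.+1 + S * g t.+1 b)
             + (1 - l) * (E t + r * g t.+1 b)) ->
  forall t b, (0 < t)%N -> (b < t)%N ->
  0 < E t + r * g t.+1 b - (P * g t.+1 b.+1 + S * g t.+1 b).
Proof.
move=> P0 S0 r0 PS hE gD gt t b.
have [n] : exists n, (D < t + n)%N by exists D.+1; rewrite addnS ltnS leq_addl.
elim: n t b => [|n IH] t b hn t0 bt.
  have tD : (D < t.+1)%N by rewrite addn0 in hn; apply: ltnW.
  have /andP[h1 h2] := hE t t0.
  by rewrite !gD// !mulr0 !addr0 subr0; apply: lt_le_trans h2.
have /andP[E1 E12] := hE t t0.
case: (ltnP D t.+1) => tD.
  by rewrite !gD// !mulr0 !addr0 subr0; apply: lt_le_trans E12.
have hn' : (D < t.+1 + n)%N by rewrite addSnnS.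
have x0 := IH t.+1 b hn' isT (leqW bt).
have x1 := IH t.+1 b.+1 hn' isT bt.
have [] := gt t.+1 b _ (leqW bt); first by rewrite ltnS t0.
move=> l0 /andP[l00 l01] e0.
have [] := gt t.+1 b.+1 _ bt; first by rewrite ltnS t0.
move=> l1 /andP[l10 l11] e1.
set A0 := P * g t.+2 b.+1 + S * g t.+2 b in x0 e0.
set I0 := E t.+1 + r * g t.+2 b in x0 e0.
set A1 := P * _ + _ in x1 e1.
set I1 := E t.+1 + r * _ in x1 e1.
have g1 : g t.+1 b.+1 <= I1 by rewrite e1; nra.
have g0I : g t.+1 b <= I0 by rewrite e0; nra.
have g0A : A0 <= g t.+1 b by rewrite e0; nra.
have PSE : 0 < E t - (P + S) * E t.+1 by nra.
have Pg1 : P * g t.+1 b.+1 <= P * I1 by apply: ler_wpM2l.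
(* The sign of [r - S] decides whether [A0] or [I0] is the useful bound for [g t.+1 b]. Either way
   the slot [t.+2] terms regroup into [E t - (P + S) * E t.+1] plus a nonnegative multiple of
   [I0 - A0]. *)
case: (lerP S r) => Sr.
- have Sg : (r - S) * A0 <= (r - S) * g t.+1 b by apply: ler_wpM2l; rewrite ?subr_ge0.
  have Sx : 0 <= S * (I0 - A0) by apply: mulr_ge0 => //; apply: ltW.
  have -> : E t + r * g t.+1 b - (P * g t.+1 b.+1 + S * g t.+1 b) =
    E t - P * g t.+1 b.+1 + (r - S) * g t.+1 b by ring.
  rewrite /A0 /I0 /I1 in Sx Sg Pg1 *; lra.
- have Sg : (S - r) * g t.+1 b <= (S - r) * I0 by apply: ler_wpM2l; rewrite ?subr_ge0 ?(ltW Sr).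
  have rx : 0 <= r * (I0 - A0) by apply: mulr_ge0 => //; apply: ltW.
  have rE : 0 <= r * E t.+1 by apply: mulr_ge0 => //; apply: ltW.
  have -> : E t + r * g t.+1 b - (P * g t.+1 b.+1 + S * g t.+1 b) =
    E t - P * g t.+1 b.+1 - (S - r) * g t.+1 b by ring.
  rewrite /A0 /I0 /I1 in rx Sg Pg1 *; lra.
Qed.

Section Access.
Context {R : realType}.
Variables (m : mdp_params R) (D : nat) (hD : (0 < D)%N).
Hypothesis hm : admissible m.
Local Notation policy := (state D -> R).
Local Notation z := (start hD).
Local Notation V := (cycle_value m hD).
Local Notation gain := (cycle_gain m hD).
Local Notation net := (net m hD).
Local Notation bias := (bias m hD).
Local Notation thr := (throughput m (D:=D)).
Local Notation acc := (access (R:=R) (D:=D)).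
Implicit Types (mu nu : policy) (s : state D).

Definition active_on_K mu := forall s, known s -> mu s = 1.

Lemma biasE f mu s : bias f mu s = average_action mu s
  (fun a => f s a - gain f mu + onward m hD (bias f mu) s a).
Proof. exact: cycle_valueE. Qed.

Lemma netE_bias f mu s : net f mu s = f s Active - f s Idle
  + (onward m hD (bias f mu) s Active - onward m hD (bias f mu) s Idle).
Proof.
rewrite /net /advantage /action_value -/(bias f mu).
by ring.
Qed.

Lemma gain_access_le1 mu : is_policy mu -> gain acc mu <= 1.
Proof.
move=> hmu; apply: cycle_gain_le => //.
apply: (@cycle_value_le _ _ _ _ hm _ _ (fun=> 0)) => // s.
have /andP[m0 m1] := hmu s.
rewrite /average_action !onward0 /=; lra.
Qed.

Lemma lookupK_bias f c mu t : active_on_K mu -> (forall s, known s -> f s Active = c) ->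
  (1 < t <= D)%N ->
  lookupK (bias f mu) t = c - gain f mu + qpp m Active * lookupK (bias f mu) t.+1.
Proof.
move=> hK hf /andP[t1 tD]; have [s hs] := at_K_ex t1 tD.
have /andP[/eqP st ks] := hs.
rewrite (lookupK_at _ hs) biasE /average_action hK// onwardE ks st hf//; ring.
Qed.

(** Active K states form a chain paying [c - gain f mu] per slot, so fewer remaining slots mean a
    smaller bias. *)
Lemma lookupK_bias_mono f c mu : active_on_K mu -> (forall s, known s -> f s Active = c) ->
  gain f mu <= c -> forall t, (1 < t)%N ->
  0 <= lookupK (bias f mu) t.+1 <= lookupK (bias f mu) t.
Proof.
move=> hK hf gc; apply: (@backward_monotone _ D (c - gain f mu) (qpp m Active)).
- by rewrite subr_ge0.
- by have /andP[/ltW] := qpp_itv hm Active.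
- by move=> t; apply: lookupK_out.
- by move=> t; apply: lookupK_bias.
Qed.

(** Values at U states are measured by their deficit [g] relative to K. Then [E] collects the access
    itself and the larger chance of a retransmission under activity; it is positive and
    nonincreasing by [lookupK_bias_mono]. *)
Lemma net_access_gt0 mu s : is_policy mu -> active_on_K mu -> ~~ known s ->
  0 < net acc mu s.
Proof.
move=> hmu hK ks.
have /andP[q0 q1] := qpp_itv hm Active; have /andP[r0 r1] := qpp_itv hm Idle.
have /andP[a0 a1] := qps_itv hm Active; have /andP[i0 i1] := qps_itv hm Idle.
have /andP[p0 p1] := pbuf_itv hm; have q01 := qpp_mono hm.
pose h := bias acc mu.
pose E t := 1 + (qpp m Active - qpp m Idle) * lookupK h t.+1.
pose g t b := lookupK h t - lookupU h t b.
pose P := qpp m Active * pbuf m.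
pose S := qpp m Active * (qps m Active - pbuf m).
pose r := qpp m Idle * qps m Idle.
have mono := lookupK_bias_mono hK (fun s _ => erefl (acc s Active)) (gain_access_le1 hmu).
have -> : net acc mu s = E (slot s) + r * g (slot s).+1 (buffered s) -
    (P * g (slot s).+1 (buffered s).+1 + S * g (slot s).+1 (buffered s)).
  rewrite netE_bias !onwardE (negbTE ks) /acc /E /r /g /P /S /h; ring.
apply: (@active_deficit_lt_idle _ D).
- by rewrite mulr_ge0 // ltW.
- by rewrite mulr_ge0 ?subr_ge0// ltW.
- by rewrite mulr_ge0 // ltW.
- by rewrite /P /S -mulrDr addrC subrK; nra.
- move=> t t0; have /andP[h0 h1] := mono t.+1 t0.
  by rewrite /E; apply/andP; split; nra.
- by move=> t b tD; rewrite /g lookupU_out ?lookupK_out ?subr0.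
- move=> t b /andP[t1 tD] bt; have [u hu] := at_U_ex (ltnW t1) tD bt.
  exists (mu u); first exact: hmu.
  have /and3P[/eqP ut /eqP ub uk] := hu.
  rewrite /g (lookupK_bias hK (fun s _ => erefl (acc s Active))) ?t1//.
  rewrite (lookupU_at _ hu) -/h /h biasE -/h /average_action !onwardE (negbTE uk) ut ub.
  by rewrite /acc /E /r /P /S /h; ring.
- exact: slot_gt0.
- exact: buffered_lt.
Qed.

(* [b * rsU] bounds what a buffer of [b] packets can still contribute. *)
Lemma gain_throughput_le mu : is_policy mu -> gain thr mu <= TsK m * gain acc mu.
Proof.
move=> hmu; rewrite -subr_le0 -mulNr -cycle_gainD.
apply: cycle_gain_le => //.
apply: le_trans (_ : (buffered z)%:R * rsU m <= 0); last by rewrite mul0r.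
apply: (cycle_value_le hm (h := fun s => (buffered s)%:R * rsU m)) => // s.
have R0 := rsU_ge0 hm.
have /andP[q0 q1] := qpp_itv hm Active; have /andP[r0 r1] := qpp_itv hm Idle.
have /andP[a0 a1] := qps_itv hm Active; have /andP[i0 i1] := qps_itv hm Idle.
have /andP[p0 p1] := pbuf_itv hm; have TK0 := TsK_ge0 hm; have TUK := TsU_pbuf_le hm.
have hK t : lookupK (fun s => (buffered s)%:R * rsU m : R) (D:=D) t = 0.
  apply: big1 => x _; case: (boolP (at_K x t)) => [/andP[_ kx]|]; last by rewrite mul0r.
  by rewrite known_buffered// mul0r mulr0.
have hU t b : 0 <= lookupU (fun s => (buffered s)%:R * rsU m : R) (D:=D) t b <= b%:R * rsU m.
  case: (pickP (fun x : state D => at_U x t b)) => [x hx|no].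
    have /and3P[_ /eqP xb _] := hx.
    by rewrite (lookupU_at _ hx) xb lexx andbT mulr_ge0// ler0n.
  rewrite /lookupU big1 ?lexx ?mulr_ge0 ?ler0n// => x _.
  by rewrite no mul0r.
have B0 : 0 <= (buffered s)%:R * rsU m by rewrite mulr_ge0// ler0n.
apply: (@le_trans _ _ (average_action mu s (fun=> (buffered s)%:R * rsU m))); last first.
  by rewrite /average_action -mulrDl addrC subrK mul1r.
apply: average_action_le => // a; rewrite onwardE hK subr0 /throughput.
case: ifP => ks.
  by rewrite mulr0 addr0; case: a; rewrite /access; lra.
have /andP[u0 u1] := hU (slot s).+1 (buffered s).
have /andP[v0 v1] := hU (slot s).+1 (buffered s).+1.
rewrite -natr1 in v1.
set b := (buffered s)%:R in B0 u1 v1 *; set u := lookupU _ _ _ in u0 u1 *.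
set v := lookupU _ _ (buffered s).+1 in v0 v1 *.
case: a; rewrite /access.
(* Relative to the trial function, activity gains at most [TsU + pbuf * rsU - TsK], which is
   nonpositive by [TsU_pbuf_le]. *)
- have h1 : qpp m Active * pbuf m * v <= pbuf m * ((b + 1) * rsU m).
    apply: le_trans (_ : pbuf m * v <= _); last exact: ler_wpM2l.
    by apply: ler_wpM2r => //; nra.
  have h2 : qpp m Active * (qps m Active - pbuf m) * u <= (qps m Active - pbuf m) * (b * rsU m).
    apply: le_trans (_ : (qps m Active - pbuf m) * u <= _); last by apply: ler_wpM2l; rewrite ?subr_ge0.
    by apply: ler_wpM2r => //; nra.
  nra.
- have h1 : qpp m Idle * qps m Idle * u <= qps m Idle * (b * rsU m).
    apply: le_trans (_ : qps m Idle * u <= _); last exact: ler_wpM2l.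
    by apply: ler_wpM2r => //; nra.
  nra.
Qed.

(** Idleness on U never fills the buffer, so all throughput is earned in K states, at [TsK] per
    access. *)
Lemma gain_throughput_init :
  gain thr (mu_init (R:=R) (D:=D)) = TsK m * gain acc (mu_init (R:=R) (D:=D)).
Proof.
apply/eqP; rewrite -subr_eq0 -mulNr -cycle_gainD /cycle_gain.
suff -> : forall s, buffered s = 0%N ->
    V (fun s a => thr s a + - TsK m * acc s a) (mu_init (R:=R) (D:=D)) s = 0.
- by rewrite mul0r.
- by [].
apply: slot_ind => s IH bs; rewrite cycle_valueE /average_action /action_value !onwardE.
have -> : lookupK (V (fun s a => thr s a + - TsK m * acc s a) (mu_init (R:=R) (D:=D))) (slot s).+1 = 0.
  apply: big1 => x _; case: (boolP (at_K x (slot s).+1)) => [/andP[/eqP sx kx]|]; last by rewrite mul0r.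
  by rewrite IH ?mulr0// ?sx// known_buffered.
have hU : lookupU (V (fun s a => thr s a + - TsK m * acc s a) (mu_init (R:=R) (D:=D))) (slot s).+1 0 = 0.
  apply: big1 => x _; case: (boolP (at_U x (slot s).+1 0)) => [/and3P[/eqP sx /eqP bx _]|]; last by rewrite mul0r.
  by rewrite IH ?mulr0// ?sx.
rewrite /mu_init /throughput /access; case: ifP => ks /=; first by ring.
by rewrite bs hU /=; ring.
Qed.

Definition lagrangian (l : R) : state D -> action -> R :=
  fun s a => thr s a + - l * acc s a.

Lemma net_lagrangian l mu s : net (lagrangian l) mu s = net thr mu s - l * net acc mu s.
Proof. by rewrite !netE /lagrangian advantageD cycle_gainD; ring. Qed.

Lemma gain_lagrangian l mu : gain (lagrangian l) mu = gain thr mu - l * gain acc mu.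
Proof. by rewrite cycle_gainD mulNr. Qed.

(** Activity on K pays the constant [TsK - l], which bounds the gain because access gains are at
    most 1. So the bias on K is nonnegative, and activity makes staying there no less likely. *)
Lemma net_lagrangian_K_ge0 l mu s : l <= TsK m -> is_policy mu -> active_on_K mu ->
  known s -> 0 <= net (lagrangian l) mu s.
Proof.
move=> lT hmu hK ks.
have g1 := gain_access_le1 hmu; have g2 := gain_throughput_le hmu.
have hc x : known x -> lagrangian l x Active = TsK m - l.
  by move=> kx; rewrite /lagrangian /throughput kx /access mulr1.
have gc : gain (lagrangian l) mu <= TsK m - l.
  by rewrite gain_lagrangian; nra.
have /andP[h0 _] := lookupK_bias_mono hK hc gc (known_slot ks).
have /andP[_ h1] := lookupK_bias_mono hK hc gc (slot_gt0 s : (1 < (slot s).+1)%N).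
have q01 := qpp_mono hm.
have hs : 0 <= lookupK (bias (lagrangian l) mu) (slot s).+1 by [].
rewrite netE_bias !onwardE ks hc// /lagrangian /throughput ks /access.
have qh : 0 <= (qpp m Active - qpp m Idle) * lookupK (bias (lagrangian l) mu) (slot s).+1.
  by rewrite mulr_ge0 ?subr_ge0.
rewrite -/(lagrangian l); lra.
Qed.

End Access.

(** * Optimality of the greedy algorithm *)

Section Greedy.
Context {R : realType}.
Variables (m : mdp_params R) (D : nat) (hD : (0 < D)%N).
Hypothesis hm : admissible m.
Local Notation policy := (state D -> R).
Local Notation z := (start hD).
Local Notation gain := (cycle_gain m hD).
Local Notation net := (net m hD).
Local Notation thr := (throughput m (D:=D)).
Local Notation acc := (access (R:=R) (D:=D)).
Local Notation lag := (lagrangian m (D:=D)).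
Local Notation mu0 := (mu_init (R:=R) (D:=D)).
Implicit Types (mu nu : policy) (s : state D) (A : {set state D}).

Lemma gain_shift f mu s x : is_policy mu -> is_policy (Defs.shift mu s x) ->
  net f mu s = 0 -> gain f (Defs.shift mu s x) = gain f mu.
Proof.
move=> hmu hs n0; apply: cycle_gain_uniq => //.
by rewrite cycle_value_shift -/(net f mu s) n0 mulr0 mul0r addr0 cycle_value_gain.
Qed.

Lemma net_shift f mu s x s' : is_policy mu -> is_policy (Defs.shift mu s x) ->
  net f mu s = 0 -> net f (Defs.shift mu s x) s' = net f mu s'.
Proof.
move=> hmu hs n0; rewrite /net (gain_shift hmu hs n0).
exact: advantage_shift.
Qed.

(* [mu], idle exactly on [A], maximizes the Lagrangian with multiplier [l]
   among the policies that are active on all K states. *)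
Definition greedy_state (l : R) mu A : Prop :=
  [/\ A \subset S_U D, forall s, mu s = (s \notin A)%:R, 0 <= l,
      forall s, s \in A -> net (lag l) mu s <= 0 &
      forall s, s \notin A -> ~~ known s -> 0 <= net (lag l) mu s].

Lemma greedy_policy l mu A : greedy_state l mu A -> is_policy mu.
Proof. by case=> _ h _ _ _ s; rewrite h; case: (_ \notin _); rewrite ?lexx ler01. Qed.

Lemma greedy_active_on_K l mu A : greedy_state l mu A -> active_on_K mu.
Proof.
case=> /fintype.subsetP AU h _ _ _ s ks; rewrite h; case: (boolP (s \in A)) => // /AU.
by rewrite inE ks.
Qed.

Lemma greedy_unknown l mu A s : greedy_state l mu A -> s \in A -> ~~ known s.
Proof. by case=> /fintype.subsetP AU _ _ _ _ /AU; rewrite inE. Qed.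

(** On U the sign conditions of [greedy_state] suffice; on K either [l <= TsK m] gives the sign, or
    both policies agree. *)
Lemma greedy_gain_max l mu A nu : greedy_state l mu A -> is_policy nu ->
  l <= TsK m \/ active_on_K nu -> gain (lag l) nu <= gain (lag l) mu.
Proof.
move=> gs hnu hK; have hmu := greedy_policy gs; have hmK := greedy_active_on_K gs.
apply: gain_le_of_advantage => // s; rewrite -/(net (lag l) mu s).
have /andP[n0 n1] := hnu s; case: (gs) => _ hA _ le0 ge0; rewrite hA.
case: (boolP (s \in A)) => sA /=.
  by rewrite subr0 mulr_ge0_le0// le0.
case: (boolP (known s)) => ks; last by rewrite mulr_le0_ge0 ?subr_le0// ge0.
case: hK => [lT|hnK]; last by rewrite hnK// subrr mul0r.
by rewrite mulr_le0_ge0 ?subr_le0// net_lagrangian_K_ge0.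
Qed.

(** Net access advantages on U are positive, so lowering the multiplier favors activity and only the
    idle states need checking. *)
Lemma greedy_lower l l' mu A : greedy_state l mu A -> 0 <= l' <= l ->
  (forall s, s \in A -> net (lag l') mu s <= 0) -> greedy_state l' mu A.
Proof.
move=> gs /andP[l'0 l'l] h'; have hmu := greedy_policy gs; have hmK := greedy_active_on_K gs.
case: gs => AU hA l0 le0 ge0; split => // s sA ks.
have := ge0 s sA ks; have := net_access_gt0 hD hm hmu hmK ks.
rewrite !net_lagrangian => n0 n1; nra.
Qed.

Lemma greedy_init : exists l, greedy_state l mu0 (S_U D).
Proof.
pose r s := `|net thr mu0 s / net acc mu0 s|.
(* This sum dominates every initial efficiency, so at this multiplier no U state is worth
   activating. *)
exists (\sum_s r s).
have h0 s : mu0 s = (s \notin S_U D)%:R by rewrite inE negbK.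
have hmu : is_policy mu0.
  by move=> s; rewrite /mu_init; case: (known s); rewrite ?lexx ler01.
split => //.
- by apply: sumr_ge0 => s _; exact: normr_ge0.
- move=> s; rewrite inE => ks; rewrite net_lagrangian subr_le0.
  have n0 : 0 < net acc mu0 s.
    by apply: net_access_gt0 => // x; rewrite /mu_init => ->.
  rewrite -ler_pdivrMr//; apply: le_trans (ler_norm _) _.
  by rewrite (bigD1 s)//= lerDl sumr_ge0// => x _; exact: normr_ge0.
- by move=> s; rewrite inE negbK => ->.
Qed.

Lemma is_policy_flip l mu A s : greedy_state l mu A -> s \in A ->
  forall x, 0 <= x <= 1 -> is_policy (Defs.shift mu s x).
Proof.
move=> gs sA x hx; apply: is_policy_shift; first exact: greedy_policy gs.
by case: gs => _ -> _ _ _; rewrite sA /= add0r.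
Qed.

Lemma greedy_flip l mu A s : greedy_state l mu A -> s \in A ->
  net (lag l) mu s = 0 -> greedy_state l (Defs.shift mu s 1) (A :\ s)%SET.
Proof.
move=> gs sA n0; have hmu := greedy_policy gs.
have hs : is_policy (Defs.shift mu s 1).
  by apply: (is_policy_flip gs sA); rewrite ler01 lexx.
case: gs => AU hA l0 le0 ge0; split => //.
- exact: fintype.subset_trans (subsetDl _ _) AU.
- move=> s'; rewrite /Defs.shift hA !inE mul1r.
  by case: eqP => [->|_] /=; rewrite ?sA /= ?add0r ?addr0.
- by move=> s'; rewrite net_shift// !inE => /andP[_ /le0].
- move=> s'; rewrite net_shift// !inE negb_and negbK => /orP[/eqP -> _|/ge0//].
  by rewrite n0.
Qed.

(* Two successive policies of the algorithm maximize the same Lagrangian. *)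
Definition greedy_step mu nu : Prop := exists l A s,
  [/\ 0 < l, greedy_state l mu A, s \in A, net (lag l) mu s = 0 &
      nu = Defs.shift mu s 1].

(** * Runs of the algorithm and Lagrangian duality *)

Variables (s0 : state D) (mut : policy -> state D -> policy).
Hypothesis hmut : forall mu s, is_policy mu ->
  is_policy (mut mu s) /\ accessible m (mut mu s) z s.
Local Notation eta := (fun mu s => efficiency m s0 (mut mu s) mu s).
Variable pick : policy -> {set state D} -> state D.
Hypothesis hpick : argmax_rule eta pick.

Lemma greedy_efficiency l mu A s : greedy_state l mu A -> s \in A ->
  eta mu s = net thr mu s / net acc mu s.
Proof.
move=> gs sA; have hmu := greedy_policy gs; have [h1 h2] := hmut s hmu.
apply: efficiencyE => //; rewrite gt_eqF//.
by apply: net_access_gt0 => //; [exact: greedy_active_on_K gs|exact: greedy_unknown gs sA].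
Qed.

(** Each stage lowers the multiplier to the largest idle efficiency, where the chosen state is
    indifferent and can be flipped. At a stop no idle state has positive efficiency, so the
    multiplier can drop to 0. *)
Lemma stages_greedy fuel l mu A (x0 : policy) : greedy_state l mu A ->
  (#|A| <= fuel)%N -> let q := stages eta pick fuel mu A in
  (forall i, (i.+1 < size q)%N -> greedy_step (nth x0 q i) (nth x0 q i.+1)) /\
  exists A', greedy_state 0 (last x0 q) A'.
Proof.
elim: fuel l mu A => [|fuel IH] l mu A gs hA /=.
  split => //; exists A; apply: (greedy_lower gs); first by rewrite lexx /=; case: gs.
  by move: hA; rewrite leqn0 cards_eq0 => /eqP -> s; rewrite inE.
case: eqP => [A0|/eqP A0] /=.
  split => //; exists A; apply: (greedy_lower gs); first by rewrite lexx /=; case: gs.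
  by move=> s; rewrite A0 inE.
have hmu := greedy_policy gs.
have [sA hmax] := hpick hmu A0; set s := pick mu A in sA hmax *.
have acc_gt0 s' : s' \in A -> 0 < net acc mu s'.
  move=> s'A; apply: net_access_gt0 => //; first exact: greedy_active_on_K gs.
  exact: greedy_unknown gs s'A.
have le_eta l' : eta mu s <= l' -> forall s', s' \in A -> net (lag l') mu s' <= 0.
  move=> hl s' s'A; rewrite net_lagrangian subr_le0 -ler_pdivrMr ?acc_gt0//.
  by rewrite -(greedy_efficiency gs s'A); apply: le_trans (hmax _ s'A) hl.
case: ifP => [e0|/negbT]; rewrite /=.
  split => //; exists A; apply: (greedy_lower gs); first by rewrite lexx /=; case: gs.
  exact: le_eta.
rewrite -ltNge => e0.
(* The multiplier does not increase: at [l] the idle state [s] has nonpositive net advantage. *)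
have hl : eta mu s <= l.
  rewrite (greedy_efficiency gs sA) ler_pdivrMr ?acc_gt0// -subr_le0 -net_lagrangian.
  by case: gs => _ _ _ + _; apply.
have gs' : greedy_state (eta mu s) mu A.
  by apply: (greedy_lower gs); [rewrite (ltW e0)|exact: le_eta].
have n0 : net (lag (eta mu s)) mu s = 0.
  rewrite net_lagrangian (greedy_efficiency gs sA) divfK ?subrr//.
  by rewrite gt_eqF ?acc_gt0.
have hA' : (#|(A :\ s)%SET| <= fuel)%N by move: hA; rewrite (cardsD1 s) sA.
have [h1 [A' h2]] := IH _ _ _ (greedy_flip gs' sA n0) hA'.
split; last by exists A'; case: (fuel) h2.
case=> [_|i hi]; last exact: h1.
exists (eta mu s), A, s; split => //.
by case: (fuel).
Qed.

(** Weak duality with complementary slackness. *)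
Lemma lagrangian_optimal (l eps : R) mu : is_policy mu -> 0 <= l ->
  gain acc mu <= eps -> l * gain acc mu = l * eps ->
  (forall nu, is_policy nu -> gain (lag l) nu <= gain (lag l) mu) ->
  optimal m s0 eps mu.
Proof.
move=> hmu l0 hW hl hmax; rewrite /optimal /Wbar /Tbar; split => //.
  by rewrite (long_run_averageE hD hm).
move=> nu hnu; rewrite !(long_run_averageE hD hm)// => hWnu.
have := hmax nu hnu; rewrite !gain_lagrangian hl.
have : l * gain acc nu <= l * eps by apply: ler_wpM2l.
lra.
Qed.

Lemma flip_crossing (eps : R) mu A l s : greedy_state l mu A -> s \in A ->
  gain acc mu <= eps -> eps < gain acc (Defs.shift mu s 1) ->
  exists2 x, 0 <= x < 1 & gain acc (Defs.shift mu s x) = eps.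
Proof.
move=> gs sA; have hmu := greedy_policy gs.
have hx x : 0 <= x <= 1 -> 0 < cycle_value m hD (unit_reward (D:=D)) (Defs.shift mu s x) z.
  by move=> h; apply: cycle_length_gt0 => //; apply: (is_policy_flip gs sA).
have L0 : 0 < cycle_value m hD (unit_reward (D:=D)) mu z by apply: cycle_length_gt0.
have L1 := hx 1; rewrite ler01 lexx in L1; have {}L1 := L1 isT.
rewrite /cycle_gain ler_pdivrMr// ltr_pdivlMr//.
set p := cycle_value m hD (visits s) mu z.
(* The cycle total of access minus [eps] is [c + x * d] along the shift; its root [- c / d] is the
   crossing. *)
pose c := cycle_value m hD acc mu z - eps * cycle_value m hD (unit_reward (D:=D)) mu z.
pose d := (advantage m hD acc mu s - eps * advantage m hD (unit_reward (D:=D)) mu s) * p.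
move=> h0 h1; rewrite !cycle_value_shift -/p in h1.
have c0 : c <= 0 by rewrite subr_le0.
have cd : 0 < c + d by rewrite /c /d; lra.
have d0 : 0 < d by lra.
exists (- c / d).
  by rewrite divr_ge0 ?oppr_ge0 ?(ltW d0)//= ltr_pdivrMr// mul1r; lra.
have hxx : 0 <= - c / d <= 1.
  by rewrite divr_ge0 ?oppr_ge0 ?(ltW d0)//= ler_pdivrMr// mul1r; lra.
have Lx := hx _ hxx.
apply: (mulIf (lt0r_neq0 Lx)); rewrite divfK ?gt_eqF// !cycle_value_shift -/p.
apply/eqP; rewrite -subr_eq0; apply/eqP.
set x := - c / d.
transitivity (c + x * d); first by rewrite /c /d; ring.
by rewrite /x divfK ?gt_eqF// subrr.
Qed.

Lemma mix_shift (l : R) mu s : mix l mu (Defs.shift mu s 1) = Defs.shift mu s (1 - l).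
Proof. by apply/funext => s'; rewrite /mix /Defs.shift; ring. Qed.

(** If [TsK m < l], optimality against the initial policy and throughput at most [TsK m] per access
    would make the flipped policy access no more than the initial one, although [eps] separates
    them. *)
Lemma greedy_multiplier_le l mu A s (eps : R) : greedy_state l mu A -> s \in A ->
  net (lag l) mu s = 0 -> gain acc mu0 < eps ->
  eps < gain acc (Defs.shift mu s 1) -> l <= TsK m.
Proof.
move=> gs sA n0 h0 h1; rewrite leNgt; apply/negP => lT.
have hmu := greedy_policy gs.
have hs : is_policy (Defs.shift mu s 1).
  by apply: (is_policy_flip gs sA); rewrite ler01 lexx.
have [l0 gi] := greedy_init; have hi := greedy_policy gi.
have := greedy_gain_max gs hi (or_intror (greedy_active_on_K gi)).
rewrite -(gain_shift hmu hs n0) !gain_lagrangian (gain_throughput_init m hD).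
have := gain_throughput_le hD hm hs.
nra.
Qed.

Lemma algorithm_output_optimal (eps : R) : Wbar m s0 mu0 < eps ->
  optimal m s0 eps (algorithm_output m s0 eta pick eps).
Proof.
have [l gi] := greedy_init; have hmu0 := greedy_policy gi.
rewrite {1}/Wbar (long_run_averageE hD hm)// => h0.
rewrite /algorithm_output.
set mus := algorithm_policies eta pick.
have [hstep [A' hlast]] := stages_greedy mu0 gi (leqnn _).
rewrite -/(algorithm_policies eta pick) -/mus in hstep hlast.
have mus0 : (0 < size mus)%N by rewrite /mus /algorithm_policies; case: #|_|.
have mu00 : nth mu0 mus 0 = mu0 by rewrite /mus /algorithm_policies; case: #|_|.
rewrite -nth_last in hlast.
(* If the last policy meets the level, it is an unconstrained maximizer, with multiplier 0. *)
case: ifP => [hW|/negbT hW].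
  have hp := greedy_policy hlast.
  rewrite /Wbar (long_run_averageE hD hm)// in hW.
  apply: (@lagrangian_optimal 0) => //; first by rewrite !mul0r.
  by move=> nu hnu; apply: (greedy_gain_max hlast) => //; left; exact: TsK_ge0.
set j := (\max_(i < _ | _) _)%N.
pose W i := Wbar m s0 (nth mu0 mus i) <= eps.
have W0 : W (Ordinal mus0) by rewrite /W /= mu00 /Wbar (long_run_averageE hD hm)// ltW.
(* Index 0 qualifies, so the maximum is attained and is not the default value 0 of an empty
   maximum. *)
have [jo Wj ej] : exists2 k : 'I_(size mus), W k & j = k.
  by rewrite /j (bigop.bigmax_eq_arg (Ordinal mus0))//; case: arg_maxnP => // k Wk _; exists k.
have jN : (j.+1 < size mus)%N.
  have hj : (j <= (size mus).-1)%N by rewrite ej -ltnS prednK.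
  rewrite -ltn_predRL ltn_neqAle hj andbT; apply/eqP => e.
  by move: hW; rewrite -e ej; rewrite /W in Wj; rewrite Wj.
have Wj1 : ~~ W j.+1.
  apply/negP => h; have := @leq_bigmax_cond _ (fun i : 'I_(size mus) => W i) (fun i => i : nat) (Ordinal jN) h.
  by rewrite /= -/j ltnn.
have {Wj} : W j by rewrite ej.
move: Wj1; rewrite /W.
have [l' [A [s [l'0 gs sA n0 ->]]]] := hstep _ jN.
set mu := nth mu0 mus j in gs n0 *.
have hmu := greedy_policy gs.
have hs := is_policy_flip gs sA.
have hs1 : is_policy (Defs.shift mu s 1) by apply: hs; rewrite ler01 lexx.
rewrite {1 2}/Wbar !(long_run_averageE hD hm)// -ltNge => h2 h1.
have lT := greedy_multiplier_le gs sA n0 h0 h2.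
set S := [set _ | _].
have [lam01 eW] : S (get S).
  have [x /andP[x0 x1] ex] := flip_crossing gs sA h1 h2.
  (* [lambda] weighs the earlier policy, so the crossing shift [x] corresponds to [1 - x]. *)
  apply: (@getPex _ S); exists (1 - x); split; first by apply/andP; split; lra.
  rewrite mix_shift subKr /Wbar (long_run_averageE hD hm)//.
  by apply: hs; rewrite x0 ltW.
move: (get S) lam01 eW => lam /andP[lam0 lam1].
have hx : is_policy (Defs.shift mu s (1 - lam)).
  by apply: hs; apply/andP; split; lra.
rewrite mix_shift /Wbar (long_run_averageE hD hm)// => eW.
(* The flipped state is indifferent at [l'], so the mixture also maximizes the Lagrangian, and it
   meets the level with equality. *)
apply: (@lagrangian_optimal l') => //; rewrite ?eW ?(ltW l'0)//.
move=> nu hnu; rewrite (gain_shift hmu hx n0).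
by apply: (greedy_gain_max gs) => //; left.
Qed.

End Greedy.

(** * Channel probabilities *)

Section ChannelAdmissible.
Context {R : realType} {d : measure_display} {Om : measurableType d}.
Context {P : probability Om R}.
Variable ch : channel P.
Hypothesis hch : channel_assumptions ch.

Lemma measurable_set_le (f g : Om -> R) : measurable_fun setT f ->
  measurable_fun setT g -> measurable [set w | f w <= g w].
Proof.
move=> mf mg; have := measurable_fun_ler mf mg measurableT.
by move/(_ [set true] I); rewrite setTI; congr measurable; apply/seteqP; split.
Qed.

Lemma measurable_set_lt (f g : Om -> R) : measurable_fun setT f ->
  measurable_fun setT g -> measurable [set w | f w < g w].
Proof.
move=> mf mg; have := measurable_fun_ltr mf mg measurableT.
by move/(_ [set true] I); rewrite setTI; congr measurable; apply/seteqP; split.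
Qed.

Lemma measurable_capacity (f : Om -> R) : measurable_fun setT f ->
  measurable_fun setT (fun w => capacity (f w)).
Proof.
move=> mf; apply: measurable_funM; last exact: measurable_cst.
apply: measurableT_comp; first exact: measurable_ln.
by apply: measurable_funD => //; exact: measurable_cst.
Qed.

Lemma measurable_sinr (f g : Om -> R) : (forall w, 0 <= g w) ->
  measurable_fun setT f -> measurable_fun setT g ->
  measurable_fun setT (fun w => f w / (1 + g w)).
Proof.
move=> g0 mf mg; apply: measurable_funM => //.
have -> : (fun w => (1 + g w)^-1) = (fun w => (1 + g w) `^ (-1)).
  by apply/funext => w; rewrite powR_inv1// addr_ge0.
apply: (@measurableT_comp _ _ _ _ _ _ (fun x : R => x `^ (-1))).
  exact: measurable_powR.
by apply: measurable_funD => //; exact: measurable_cst.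
Qed.

Let gs_ge0 w : 0 <= gs ch w. Proof. by case: (snr_ge0 hch w). Qed.
Let gps_ge0 w : 0 <= gps ch w. Proof. by case: (snr_ge0 hch w). Qed.

Lemma measurable_snr_both : measurable (snr_in ch (Gamma_both ch)).
Proof.
rewrite (_ : snr_in _ _ = [set w | RsU ch <= capacity (gs ch w)] `&`
  [set w | Rp ch <= capacity (gps ch w)] `&`
  [set w | RsU ch + Rp ch <= capacity (gs ch w + gps ch w)]).
  apply: measurableI; first apply: measurableI;
    apply: measurable_set_le => //; apply: measurable_capacity => //.
  exact: measurable_funD.
apply/seteqP; split => w; rewrite /snr_in /Gamma_both /=; first by case.
by case=> -[].
Qed.

Lemma measurable_snr_p : measurable (snr_in ch (Gamma_p ch)).
Proof.
rewrite (_ : snr_in _ _ = snr_in ch (Gamma_both ch) `|`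
  ([set w | capacity (gs ch w) < RsU ch] `&`
  [set w | Rp ch <= capacity (gps ch w / (1 + gs ch w))])) //.
apply: measurableU; first exact: measurable_snr_both.
apply: measurableI; first by apply: measurable_set_lt => //; exact: measurable_capacity.
by apply: measurable_set_le => //; apply: measurable_capacity; exact: measurable_sinr.
Qed.

Lemma measurable_snr_s : measurable (snr_in ch (Gamma_s ch)).
Proof.
rewrite (_ : snr_in _ _ = snr_in ch (Gamma_both ch) `|`
  ([set w | capacity (gps ch w) < Rp ch] `&`
  [set w | RsU ch <= capacity (gs ch w / (1 + gps ch w))])) //.
apply: measurableU; first exact: measurable_snr_both.
apply: measurableI; first by apply: measurable_set_lt => //; exact: measurable_capacity.
by apply: measurable_set_le => //; apply: measurable_capacity; exact: measurable_sinr.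
Qed.

Lemma measurable_snr_buf : measurable (snr_in ch (Gamma_buf ch)).
Proof.
rewrite (_ : snr_in _ _ =
  ~` (snr_in ch (Gamma_p ch) `|` snr_in ch (Gamma_s ch)) `&`
  [set w | RsU ch <= capacity (gs ch w)]) //.
apply: measurableI; last by apply: measurable_set_le => //; exact: measurable_capacity.
apply: measurableC; apply: measurableU; first exact: measurable_snr_p.
exact: measurable_snr_s.
Qed.

Lemma le_Pr (A B : set Om) : measurable A -> measurable B -> A `<=` B ->
  Pr (P:=P) A <= Pr (P:=P) B.
Proof.
move=> mA mB AB; rewrite /Pr fine_le ?fin_num_measure//.
by apply: le_measure => //; rewrite inE.
Qed.

Lemma admissible_of_channel : admissible (params_of_channel ch).
Proof.
have mnp : measurable (snr_in ch (~` Gamma_p ch)).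
  by rewrite (_ : snr_in _ _ = ~` snr_in ch (Gamma_p ch))//; apply: measurableC; exact: measurable_snr_p.
have qA1 : ch_qps ch Active <= 1.
  have -> : 1 = Pr (P:=P) setT by rewrite /Pr probability_setT.
  exact: le_Pr.
(* Buffering happens only outside [Gamma_p], when the PU packet is not decoded. *)
have bq : ch_pbuf ch <= ch_qps ch Active.
  apply: le_Pr => //; first exact: measurable_snr_buf.
  by move=> w [h _] hp; apply: h; left.
have [Rp0 RU0 RK0] := rates_gt0 hch.
have [q0 q1 q2] := And3 (qppI_gt0 hch) (qpp_le hch) (qppA_lt1 hch).
have [s0 s1] := conj (qpsI_gt0 hch) (qps_lt hch).
split => /=.
- by case; apply/andP; split; lra.
- exact: q1.
- by case; apply/andP; split; lra.
- by rewrite bq ltW// (pbuf_gt0 hch).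
- exact: ltW.
- by apply: mulr_ge0; [exact: ltW|apply: fine_ge0; exact: measure_ge0].
- exact: TsK_ge hch.
Qed.

End ChannelAdmissible.

Theorem theorem1 (R : realType) (d : measure_display) (Om : measurableType d)
  (P : probability Om R) (ch : channel P) (hch : channel_assumptions ch)
  (D : nat) (hD : (0 < D)%N) (s0 : state D)
  (epsPU Ps Pth : R) (hPU : 0 <= epsPU <= 1) (hPs : 0 < Ps)
  (hPth : 0 <= Pth <= Ps)
  (mut : (state D -> R) -> state D -> state D -> R)
  (hmut : forall (mu : state D -> R) (s : state D), is_policy mu ->
    is_policy (mut mu s) /\
    accessible (params_of_channel ch) (mut mu s) (start hD) s)
  (pick : (state D -> R) -> {set state D} -> state D)
  (hpick : argmax_rule
    (fun mu s => efficiency (params_of_channel ch) s0 (mut mu s) mu s) pick)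
  (heps : eps_th (params_of_channel ch) s0
          < eps_W (params_of_channel ch) epsPU Pth Ps) :
  optimal (params_of_channel ch) s0
    (eps_W (params_of_channel ch) epsPU Pth Ps)
    (algorithm_output (params_of_channel ch) s0
      (fun mu s => efficiency (params_of_channel ch) s0 (mut mu s) mu s) pick
      (eps_W (params_of_channel ch) epsPU Pth Ps)).
Proof.
exact: (algorithm_output_optimal (admissible_of_channel hch) hmut hpick heps).
Qed.
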